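(* Let $n\ge 3$ and let $S\subseteq\{1,\dots,n-2\}$ with $1\notin S$. Then $b_S(n)>0$.
   Context: $\Pi_n$ is the lattice of set partitions of $\{1,\dots,n\}$ ordered by refinement, with minimum $\hat 0$ (all singletons) and maximum $\hat 1$ (one block); the rank of a partition with $k$ blocks is $n-k$, so the proper part has ranks $1,\dots,n-2$. The symmetric group $S_n$ acts on $\Pi_n$ by permuting $\{1,\dots,n\}$, preserving order and rank, and hence permutes chains. For $T\subseteq\{1,\dots,n-2\}$ let $\alpha_T$ be the permutation representation of $S_n$ (over $\mathbb{C}$) on the set of chains $\hat 0<x_1<\dots<x_k<\hat 1$ whose set of ranks $\{\mathrm{rk}(x_1),\dots,\mathrm{rk}(x_k)\}$ is exactly $T$. For $S\subseteq\{1,\dots,n-2\}$ put $\beta_S=\sum_{T\subseteq S}(-1)^{|S-T|}\alpha_T$ (a virtual representation, which equals the $S_n$-representation on the top reduced homology of the order complex of the rank-selected subposet $\Pi_n^S$ consisting of the elements whose rank lies in $S$). Let $b_S(n)=\langle \beta_S,1\rangle$ denote the multiplicity of the trivial representation of $S_n$ in $\beta_S$. *)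

(* Defs.v *)
From mathcomp Require Import all_boot all_order all_algebra all_fingroup.
From mathcomp Require Import all_solvable all_field all_character.

Set Implicit Arguments.
Unset Strict Implicit.
Unset Printing Implicit Defensive.

Import GroupScope GRing.Theory.

Section PermutationRepresentation.

Variables (gT : finGroupType) (G : {group gT}) (rT : finType).
Variables (to : {action gT &-> rT}) (X : {set rT}).
Hypothesis nXG : [acts G, on X | to].

(* Rows are acted on from the right, so the basis vector e_x goes to e_(x.g). *)
Definition perm_mx_of (g : gT) : 'M[algC]_#|X| :=
  \matrix_(i, j) (to (enum_val i) g == enum_val j)%:R%R.

Lemma perm_mx_of_repr : mx_repr G perm_mx_of.
Proof.
split=> [|g h Gg Gh]; apply/matrixP=> i j; rewrite !mxE.
  by rewrite act1 (inj_eq enum_val_inj).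
have [k0 def_k0] : {k0 : 'I_#|X| | enum_val k0 = to (enum_val i) g}.
  have Xig : to (enum_val i) g \in X by rewrite (acts_act nXG Gg) enum_valP.
  by exists (enum_rank_in Xig (to (enum_val i) g)); rewrite enum_rankK_in.
rewrite (bigD1 k0) //= !mxE actM -def_k0 eqxx mul1r big1 ?addr0 // => k neq_k.
by rewrite !mxE -def_k0 (inj_eq enum_val_inj) eq_sym (negPf neq_k) mul0r.
Qed.

Definition perm_repr : mx_representation algC G #|X| :=
  MxRepresentation perm_mx_of_repr.

End PermutationRepresentation.

(* The ground set {1, ..., n} is rendered as 'I_n; a set partition of it is a *)
(* P : {set {set 'I_n}} such that partition P [set: 'I_n].                    *)
Section PartitionLattice.

Variable n : nat.
Implicit Types (P Q : {set {set 'I_n}}) (C : {set {set {set 'I_n}}}).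

Definition refines P Q : bool :=
  [forall A in P, [exists B in Q, A \subset B]].

Definition strictly_refines P Q : bool := (P != Q) && refines P Q.

Definition Pi_bot : {set {set 'I_n}} := [set [set i] | i : 'I_n].
Definition Pi_top : {set {set 'I_n}} := [set [set: 'I_n]].

Definition Pi_rank P : nat := n - #|P|.

Definition Pi_proper : {set {set {set 'I_n}}} :=
  [set P | [&& partition P [set: 'I_n],
               strictly_refines Pi_bot P & strictly_refines P Pi_top]].

(* A chain 0 < x_1 < ... < x_k < 1 is encoded by the set {x_1, ..., x_k}. *)
Definition is_chain C : bool :=
  (C \subset Pi_proper) &&
  [forall P in C, forall Q in C, refines P Q || refines Q P].

(* For n > 0 the ranks in Pi_n are 0, ..., n - 1, whence the type 'I_n. *)
Definition rank_set C : {set 'I_n} :=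
  [set r : 'I_n | [exists P in C, Pi_rank P == r]].

Definition chains (T : {set 'I_n}) : {set {set {set {set 'I_n}}}} :=
  [set C | is_chain C && (rank_set C == T)].

(* 'P is the natural action on 'I_n, lifted to blocks, then to partitions, *)
(* then to sets of partitions.                                             *)
Definition block_act : {action 'S_n &-> {set 'I_n}} := ('P^*)%act.
Definition part_act : {action 'S_n &-> {set {set 'I_n}}} := (block_act^*)%act.
Definition chain_act : {action 'S_n &-> {set {set {set 'I_n}}}} :=
  (part_act^*)%act.

Lemma block_act_sub (A B : {set 'I_n}) (s : 'S_n) :
  (block_act A s \subset block_act B s) = (A \subset B).
Proof.
apply/idP/idP=> [sAB | ]; last exact: imsetS.
apply/subsetP=> x Ax.
have /imsetP[y By] : 'P%act x s \in block_act B s.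
  by rewrite (subsetP sAB) //; apply: imset_f.
by move/(act_inj 'P)->.
Qed.

Lemma card_part_act P (s : 'S_n) : #|part_act P s| = #|P|.
Proof. by rewrite card_setact. Qed.

Lemma refines_act P Q (s : 'S_n) :
  refines P Q -> refines (part_act P s) (part_act Q s).
Proof.
move=> /forall_inP rPQ; apply/forall_inP=> _ /imsetP[A PA ->].
have /exists_inP[B QB sAB] := rPQ A PA.
apply/exists_inP; exists (block_act B s); last by rewrite block_act_sub.
exact: imset_f.
Qed.

Lemma strictly_refines_act P Q (s : 'S_n) :
  strictly_refines P Q -> strictly_refines (part_act P s) (part_act Q s).
Proof.
case/andP=> neqPQ /(refines_act s) rPQ; rewrite /strictly_refines rPQ andbT.
by rewrite (inj_eq (act_inj part_act s)).
Qed.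

Lemma setT_act (s : 'S_n) : block_act [set: 'I_n] s = [set: 'I_n].
Proof.
by apply/eqP; rewrite eqEcard subsetT card_setact /=.
Qed.

Lemma Pi_top_act (s : 'S_n) : part_act Pi_top s = Pi_top.
Proof. by rewrite [LHS]imset_set1 setT_act. Qed.

Lemma Pi_bot_act (s : 'S_n) : part_act Pi_bot s = Pi_bot.
Proof.
apply/eqP; rewrite eqEcard card_part_act leqnn andbT.
apply/subsetP=> _ /imsetP[_ /imsetP[i _ ->] ->].
by apply/imsetP; exists (s i); rewrite //= [LHS]imset_set1.
Qed.

Lemma partition_act P (s : 'S_n) :
  partition P [set: 'I_n] -> partition (part_act P s) [set: 'I_n].
Proof.
case/and3P=> /eqP covP /trivIsetP tiP P'0; apply/and3P; split.
- apply/eqP/setP=> x; rewrite inE; apply/bigcupP.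
  have : s^-1 x \in cover P by rewrite covP inE.
  case/bigcupP=> A PA Ax; exists (block_act A s); first exact: imset_f.
  by apply/imsetP; exists (s^-1 x); rewrite //= apermE permKV.
- apply/trivIsetP=> _ _ /imsetP[A PA ->] /imsetP[B PB ->] neqAB.
  have /tiP: A != B by apply: contraNneq neqAB => ->.
  move=> /(_ PA PB); rewrite -!setI_eq0 => dAB.
  apply: contraT => /set0Pn[_ /setIP[/imsetP[a Aa ->] /imsetP[b Bb]]].
  move/(act_inj 'P) => eab.
  by move/eqP/setP/(_ a): dAB; rewrite !inE Aa eab Bb.
- apply: contra P'0 => /imsetP[A PA] /esym/eqP.
  by rewrite imset_eq0 => /eqP <-.
Qed.

Lemma Pi_proper_act P (s : 'S_n) :
  P \in Pi_proper -> part_act P s \in Pi_proper.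
Proof.
rewrite !inE => /and3P[pP /(strictly_refines_act s) + ].
move=> + /(strictly_refines_act s).
by rewrite Pi_bot_act Pi_top_act partition_act // => -> ->.
Qed.

Lemma is_chain_act C (s : 'S_n) : is_chain C -> is_chain (chain_act C s).
Proof.
case/andP=> /subsetP sC /forall_inP cC; apply/andP; split.
  by apply/subsetP=> _ /imsetP[P CP ->]; apply/Pi_proper_act/sC.
apply/forall_inP=> _ /imsetP[P CP ->].
apply/forall_inP=> _ /imsetP[Q CQ ->].
by have /forall_inP/(_ Q CQ)/orP[] := cC P CP => /(refines_act s) ->;
  rewrite ?orbT.
Qed.

Lemma rank_set_act C (s : 'S_n) : rank_set (chain_act C s) = rank_set C.
Proof.
apply/setP=> r; rewrite !inE; apply/exists_inP/exists_inP.
  case=> _ /imsetP[P CP ->]; rewrite /Pi_rank card_part_act => rP.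
  by exists P.
case=> P CP rP; exists (part_act P s); first exact: imset_f.
by rewrite /Pi_rank card_part_act.
Qed.

Lemma acts_chains (T : {set 'I_n}) :
  [acts [set: 'S_n], on chains T | chain_act].
Proof.
apply/actsP=> s _ C; apply/idP/idP; rewrite !inE => /andP[cC /eqP rC].
  have := is_chain_act s^-1 cC; rewrite actK => ->.
  by rewrite -rC rank_set_act eqxx.
by rewrite is_chain_act //= rank_set_act rC.
Qed.

Definition alpha_repr (T : {set 'I_n}) :
    mx_representation algC [set: 'S_n] #|chains T| :=
  perm_repr (acts_chains T).

(* Virtual representations are represented by their characters. *)
Definition alpha (T : {set 'I_n}) : 'CF([set: 'S_n]) := cfRepr (alpha_repr T).

Definition beta (S : {set 'I_n}) : 'CF([set: 'S_n]) :=
  (\sum_(T : {set 'I_n} | T \subset S) (-1) ^+ #|S :\: T| *: alpha T)%R.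

Definition b_mult (S : {set 'I_n}) : algC := '[beta S, 1]%R.

End PartitionLattice.

(* Main.v *)
Require Import Defs.
From mathcomp Require Import all_boot all_order all_algebra all_fingroup.
From mathcomp Require Import all_solvable all_field all_character.
Set Implicit Arguments.
Unset Strict Implicit.
Unset Printing Implicit Defensive.
Import Order.TTheory GRing.Theory Num.Theory.

(* Let F_T be the space of functions on the chains with rank set S that only  *)
(* depend on the elements of rank in T, and B_T the orthogonal complement in  *)
(* F_T of the sum of the F_(T - i), i in T.  Then F_T is the sum of the B_U,  *)
(* U a subset of T, also after taking S_n-invariants.  This sum is direct:    *)
(* recording which block minima disappear at each step of a chain is an       *)
(* EL-labelling of Pi_n, and a function in B_T is determined by its values on *)
(* the chains with descent set T, because an ascent is the unique maximizer   *)
(* of the sum of the block minima among the elements that may replace it.     *)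
(* Hence dim B_T is at most the number of these chains, and dimensions add    *)
(* up.  Taking invariants and inverting, b_S(n) = dim B_S^(S_n), the space of *)
(* invariant top cycles of the rank-selected subposet.                        *)
(* A nonzero invariant cycle comes from the boolean lattice of partitions of  *)
(* {0, ..., n - 1} into intervals: a set A of points, with 0 in A, encodes    *)
(* the partition joining p to p - 1 for each nonzero p in A.  Put             *)
(* I_s = {0, ..., s} and let W be the set of permutations preserving I_s for  *)
(* each s not in S.  Then z = sum_(w in W) sgn(w) [the chain of the w(I_s)]   *)
(* is a cycle, by the involutions w -> w o (s s+1), s in S.  The coefficient  *)
(* of the chain w = 1 in the symmetrization of z is positive: if g maps the   *)
(* chain of 1 to that of w, then every w(I_s) has a single big block; since 1 *)
(* is not in S, this block contains 0 and 1, so w(I_s) = I_s, whence w = 1.   *)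

(** * Moebius inversion and spaces of functions constant on fibres *)

(** The multiplicity is shown to be a dimension, and a nonzero vector in the corresponding space
    makes it positive. [fibmx] realizes F_T and [prim_mx] realizes B_T, over the rationals so that
    orthogonal complements are direct; [key H T] adds invariance under H. The dimension formula is
    [b_mult_rank]: by orbit counting ([cfdot_perm_repr], [rank_key]) the multiplicity of 1 in
    alpha_T is the dimension of the invariants of F_T, which is the sum of the dimensions of the
    invariants of the B_U ([rank_fibmx_prim]), and [moebius_subset] inverts this. Directness is
    obtained for the trivial group in [mxdirect_prim], from [prim_key1_separating], which rests on
    [asc_max] and [asc_restr]; [prim_key_sub] carries it over to S_n. The vector is built in
    [rank_prim_key_gt0]: [cycle_sum_fibre] makes z a cycle and [cycle_chain_orbit] excludes
    cancellation. That 1 is not in S enters through [initseg_perms_small]. *)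

Section MoebiusSubsets.
Local Open Scope ring_scope.

Lemma moebius_subset (R : comPzRingType) (I : finType) (r : {set I} -> R)
    (S : {set I}) :
  \sum_(T : {set I} | T \subset S) (-1) ^+ #|S :\: T| *
     (\sum_(U : {set I} | U \subset T) r U) = r S.
Proof.
under eq_bigr => T _ do rewrite mulr_sumr.
rewrite (exchange_big_dep (fun U : {set I} => U \subset S)) /=; last first.
  by move=> T U TS UT; apply: subset_trans TS.
have key (U : {set I}) : U \subset S ->
    \sum_(T : {set I} | (T \subset S) && (U \subset T)) (-1) ^+ #|S :\: T| =
    (S \subset U)%:R :> R.
  move=> US.
  (* The signed sum over the T between U and S comes from expanding a product over points: [F i] is
     the weight of i in T, [G i] that of i outside T. The factor at a point of S outside U is 1 - 1
     = 0, every other factor is 1. *)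
  pose F (i : I) : R := (i \in S)%:R.
  pose G (i : I) : R := if i \in S then - (i \notin U)%:R else 1.
  transitivity (\prod_i (F i + G i)).
    rewrite bigA_distr big_mkcond; apply: eq_bigr => T _ /=.
    case: ifP => [/andP[TS UT]|].
      rewrite -sum1_card [RHS](bigID (mem (S :\: T))) /= [X in _ * X]big1 ?mulr1.
        rewrite (eq_bigr (fun=> -1)) ?prodr_const ?sum1_card // => i.
        rewrite inE => /andP[iT iS]; rewrite (negPf iT) /G iS.
        by rewrite (contraNN (subsetP UT i)).
      move=> i; rewrite inE negb_and negbK => /orP[iT|iS].
        by rewrite iT /F (subsetP TS).
      by rewrite (negPf (contraNN (subsetP TS i) iS)) /G (negPf iS).
    move/negbT; rewrite negb_and => /orP[/subsetPn[i iT iS]|/subsetPn[i iU iT]].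
      by rewrite (bigD1 i) //= iT /F (negPf iS) mul0r.
    rewrite (bigD1 i) //= (negPf iT) /G (subsetP US) // iU.
    by rewrite oppr0 mul0r.
  case: (boolP (S \subset U)) => [SU|/subsetPn[i iS iU]].
    apply: big1 => i _; rewrite /F /G; case: ifP => iS; rewrite ?add0r //.
    by rewrite (subsetP SU) // oppr0 addr0.
  by rewrite (bigD1 i) //= /F /G iS iU addrN mul0r.
under eq_bigr => U US do
  rewrite -mulr_suml key //.
rewrite (bigD1 S) //= subxx mul1r big1 ?addr0 // => U /andP[US neU].
by rewrite [S \subset U]negbTE ?mul0r //; apply: contra neU; rewrite eqEsubset US.
Qed.

End MoebiusSubsets.

(** * Functions constant on the fibres of a map *)

Section FibreSpaces.
Local Open Scope ring_scope.
Variables (N : nat) (K : finType).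
Implicit Types (k : 'I_N -> K) (u : 'rV[rat]_N).

(* The row space consists of the functions on 'I_N that factor through k. *)
Definition fibmx k : 'M[rat]_(#|K|, N) :=
  \matrix_(o, i) (k i == enum_val o)%:R.

Lemma sub_fibmxP k u :
  reflect (forall i j, k i = k j -> u 0 i = u 0 j) (u <= fibmx k)%MS.
Proof.
apply: (iffP idP) => [/submxP[v ->] i j kij|ku].
  by rewrite !mxE; apply: eq_bigr => o _; rewrite !mxE kij.
pose v : 'rV[rat]_#|K| :=
  \row_o (if [pick i | k i == enum_val o] is Some i then u 0 i else 0).
suff -> : u = v *m fibmx k by apply: submxMl.
apply/rowP=> i; rewrite !mxE (bigD1 (enum_rank (k i))) //= !mxE enum_rankK eqxx.
rewrite mulr1 big1 ?addr0 => [|o neo].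
  by case: pickP => [j /eqP kj|/(_ i)]; [apply: ku|rewrite eqxx].
by rewrite !mxE -(inj_eq enum_rank_inj) enum_valK eq_sym (negPf neo) mulr0.
Qed.

(** The nonzero rows are indicators of disjoint nonempty fibres, hence independent. *)
Lemma rank_fibmx k : \rank (fibmx k) = #|[set k i | i : 'I_N]|.
Proof.
pose A := [set k i | i : 'I_N].
pose f (a : 'I_#|A|) : 'I_#|K| := enum_rank (enum_val a).
have kf (a : 'I_#|A|) : {i | k i = enum_val a}.
  have /imsetP/sig2_eqW[i _ ->] : enum_val a \in A := enum_valP a.
  by exists i.
have fi : injective f by move=> a b /enum_rank_inj/enum_val_inj.
have eqs : (fibmx k :=: rowsub f (fibmx k))%MS.
  apply/eqmxP; rewrite rowsub_sub andbT; apply/row_subP=> o.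
  have [|noA] := boolP (enum_val o \in A) => [oA|].
    have -> : o = f (enum_rank_in oA (enum_val o)).
      by rewrite /f enum_rankK_in // enum_valK.
    by rewrite -row_rowsub; apply: row_sub.
  suff -> : row o (fibmx k) = 0 by apply: sub0mx.
  apply/rowP=> i; rewrite !mxE; case: eqP => // kio.
  by case/negP: noA; rewrite -kio imset_f.
rewrite eqs; apply/eqP; rewrite -/(row_free _) -kermx_eq0.
apply/rowV0P=> v /sub_kermxP/rowP vM; apply/rowP=> a.
have [i ki] := kf a; have := vM i; rewrite !mxE (bigD1 a) //= !mxE ki enum_rankK.
rewrite eqxx mulr1 big1 ?addr0 // => b neb.
by rewrite !mxE ki enum_rankK (inj_eq enum_val_inj) eq_sym (negPf neb) mulr0.
Qed.

Lemma sub_ker_fibmxP k u :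
  reflect (forall o, \sum_(i | k i == o) u 0 i = 0)
          (u <= kermx (fibmx k)^T)%MS.
Proof.
have E o : (u *m (fibmx k)^T) 0 o = \sum_(i | k i == enum_val o) u 0 i.
  rewrite mxE [RHS]big_mkcond; apply: eq_bigr => i _; rewrite !mxE.
  by case: eqP; rewrite ?mulr1 ?mulr0.
apply: (iffP sub_kermxP) => [/rowP u0 o|u0].
  by have := u0 (enum_rank o); rewrite E enum_rankK mxE.
by apply/rowP=> o; rewrite E mxE.
Qed.

End FibreSpaces.

(** * Orthogonal complements of row spaces *)

Section Orthogonal.
Local Open Scope ring_scope.
Variables (F : realFieldType) (n : nat).

Lemma row_dot_eq0 (u : 'rV[F]_n) : u *m u^T = 0 -> u = 0.
Proof.
move/matrixP/(_ 0 0); rewrite !mxE => /eqP.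
rewrite psumr_eq0 => [/allP u0|i _]; last by rewrite mxE -expr2 sqr_ge0.
apply/rowP=> i; have := u0 i (mem_index_enum i); rewrite !mxE mulf_eq0 orbb.
by move/eqP.
Qed.

(** [kermx W^T] is the orthogonal complement of the row space of W; over an ordered field a sum of
    squares vanishes only at 0. *)
Lemma orthomx_cap (m : nat) (W : 'M[F]_(m, n)) : (W :&: kermx W^T = 0)%MS.
Proof.
apply/eqP/rowV0P=> u; rewrite sub_capmx => /andP[/submxP[a ua] /sub_kermxP uW].
by apply: row_dot_eq0; rewrite [in X in _ *m X]ua trmx_mul mulmxA uW mul0mx.
Qed.

Lemma orthomx_full (m : nat) (W : 'M[F]_(m, n)) : row_full (W + kermx W^T)%MS.
Proof.
rewrite /row_full -(eqn_add2r (\rank (W :&: kermx W^T)%MS)) mxrank_sum_cap.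
by rewrite orthomx_cap mxrank0 addn0 mxrank_ker mxrank_tr subnKC ?rank_leq_col.
Qed.

Lemma orthomx_split (m p : nat) (W : 'M[F]_(m, n)) (A : 'M[F]_(p, n)) :
  (W <= A -> A :=: W + (A :&: kermx W^T))%MS.
Proof.
move=> WA; apply/eqmxP; rewrite addsmx_sub WA capmxSl andbT.
rewrite [(A :&: _)%MS]capmxC matrix_modl // sub_capmx submx_refl andbT.
by rewrite submx_full ?orthomx_full.
Qed.

End Orthogonal.

(** * Decomposition into the spaces B_T *)

Section PrimitiveParts.
Local Open Scope ring_scope.
Variables (N : nat) (I K : finType).
Implicit Types (k : {set I} -> 'I_N -> K) (S T U : {set I}).

Definition lower_mx k T : 'M[rat]_N := (\sum_(i in T) <<fibmx (k (T :\ i))>>)%MS.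

Definition prim_mx k T : 'M[rat]_N := (fibmx (k T) :&: kermx (lower_mx k T)^T)%MS.

Definition coherent k := forall T U, T \subset U ->
  forall i j, k U i = k U j -> k T i = k T j.

(** For T = S and k the restriction of chains, the second condition is the cycle equation: the
    values on all chains obtained by refilling rank t sum to 0. *)
Lemma sub_prim_mxP k T (u : 'rV_N) :
  reflect ((forall i j, k T i = k T j -> u 0 i = u 0 j) /\
           (forall t, t \in T -> forall o, \sum_(i | k (T :\ t) i == o) u 0 i = 0))
          (u <= prim_mx k T)%MS.
Proof.
have E m (W : 'M[rat]_(m, N)) : (u <= kermx W^T)%MS = (W <= kermx u^T)%MS.
  apply/sub_kermxP/sub_kermxP => h; apply: trmx_inj.
    by rewrite trmx_mul trmxK h trmx0.
  by rewrite trmx_mul trmxK h trmx0.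
rewrite sub_capmx E.
apply: (iffP andP) => [[/sub_fibmxP uT /sumsmx_subP h]|[uT h]]; split=> //.
- by move=> t tT; apply/sub_ker_fibmxP; rewrite E -(genmxE (fibmx _)); apply: h.
- exact/sub_fibmxP.
- by apply/sumsmx_subP=> t tT; rewrite genmxE -E; apply/sub_ker_fibmxP/h.
Qed.

Lemma fibmxS k T U : coherent k -> T \subset U -> (fibmx (k T) <= fibmx (k U))%MS.
Proof.
move=> ck TU; apply/row_subP=> o; apply/sub_fibmxP=> i j kij; rewrite !mxE.
by rewrite (ck _ _ TU _ _ kij).
Qed.

Lemma fibmx_sum_prim k T : coherent k ->
  (fibmx (k T) :=: \sum_(U : {set I} | U \subset T) prim_mx k U)%MS.
Proof.
move=> ck; apply/eqmxP/andP; split; last first.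
  by apply/sumsmx_subP=> U UT; apply: submx_trans (fibmxS ck UT); apply: capmxSl.
have [m] := ubnP #|T|; elim: m T => // m IH T /ltnSE leT.
have lowT : (lower_mx k T <= fibmx (k T))%MS.
  by apply/sumsmx_subP=> t tT; rewrite genmxE fibmxS ?subD1set.
rewrite (orthomx_split lowT) addsmx_sub; apply/andP; split; last exact: (sumsmx_sup T).
apply/sumsmx_subP=> t tT; rewrite genmxE.
have/IH h : (#|T :\ t| < m)%N by move: leT; rewrite (cardsD1 t) tT.
apply: submx_trans h _; apply/sumsmx_subP=> U UT.
by rewrite (sumsmx_sup U) // (subset_trans UT) ?subD1set.
Qed.

(** Restriction to the coordinates in J, multiplication by [E], is injective on the row space of
    A. *)
Lemma rank_le_separating m (A : 'M[rat]_(m, N)) (J : {set 'I_N}) :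
  (forall u : 'rV_N, (u <= A)%MS -> (forall j, j \in J -> u 0 j = 0) -> u = 0) ->
  (\rank A <= #|J|)%N.
Proof.
move=> sepJ; pose E := colsub (@enum_val _ (mem J)) (1%:M : 'M[rat]_N).
rewrite -(mxrank_mul_ker A E) [(_ :&: _)%MS](_ : _ = 0) ?mxrank0 ?addn0 ?rank_leq_col //.
apply/eqP/rowV0P=> u; rewrite sub_capmx => /andP[uA /sub_kermxP uE].
apply: sepJ => // j jJ; have /rowP/(_ (enum_rank_in jJ j)) := uE.
by rewrite mulmx_colsub mulmx1 !mxE enum_rankK_in.
Qed.

Variables (S : {set I}) (k1 k2 : {set I} -> 'I_N -> K) (des : 'I_N -> {set I}).
Hypotheses (ck1 : coherent k1) (k1S : injective (k1 S)).
Hypothesis sep1 : forall T (u : 'rV_N), T \subset S ->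
  (u <= prim_mx k1 T)%MS -> (forall j, des j = T -> u 0 j = 0) -> u = 0.

(** Dimension count: as [k1 S] is injective, the sum is the whole space, of dimension N, while dim
    B_U is at most the number of j with [des j = U]. These numbers add up to at most N. *)
Lemma mxdirect_prim : mxdirect (\sum_(U : {set I} | U \subset S) prim_mx k1 U).
Proof.
rewrite mxdirectEgeq /= -(fibmx_sum_prim S ck1) rank_fibmx card_imset // card_ord.
apply: (@leq_trans (\sum_(U : {set I} | U \subset S) #|[set j | des j == U]|)).
  apply: leq_sum => U US; apply: rank_le_separating => u uU u0.
  by apply: (sep1 US uU) => j dj; apply: u0; rewrite inE dj.
rewrite -[leqRHS]card_ord -sum1_card (partition_big des xpredT) //=.
rewrite [leqRHS](bigID (fun U : {set I} => U \subset S)) /=.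
rewrite (eq_bigr (fun U => \sum_(i | des i == U) 1)%N) ?leq_addr // => U _.
by rewrite sum1dep_card.
Qed.

Hypotheses (ck2 : coherent k2).
Hypothesis prim21 : forall T, T \subset S -> (prim_mx k2 T <= prim_mx k1 T)%MS.

(** Directness passes from the B_U of [k1] to their subspaces, the B_U of [k2]. *)
Lemma rank_fibmx_prim T : T \subset S ->
  \rank (fibmx (k2 T)) = (\sum_(U : {set I} | U \subset T) \rank (prim_mx k2 U))%N.
Proof.
move=> TS; rewrite (fibmx_sum_prim T ck2); apply: mxdirectP.
apply/mxdirect_sumsP=> U UT; apply/eqP; rewrite -submx0.
have US := subset_trans UT TS.
rewrite -[X in (_ <= X)%MS](mxdirect_sumsP mxdirect_prim U US) capmxS ?prim21 //=.
apply/sumsmx_subP=> V /andP[VT neVU].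
have VS := subset_trans VT TS.
by apply: (sumsmx_sup V); rewrite ?VS // prim21.
Qed.

Lemma moebius_rank_fibmx (R : comPzRingType) :
  \sum_(T : {set I} | T \subset S) (-1) ^+ #|S :\: T| *
     (\rank (fibmx (k2 T)))%:R = (\rank (prim_mx k2 S))%:R :> R.
Proof.
rewrite -(moebius_subset (fun U => (\rank (prim_mx k2 U))%:R)).
by apply: eq_bigr => T TS; rewrite rank_fibmx_prim // natr_sum.
Qed.

End PrimitiveParts.

(** * Set partitions through their block minima *)

Section BlockMinima.
Variable n : nat.
Implicit Types (P Q R : {set {set 'I_n}}) (p q : 'I_n).

Definition is_part P := partition P [set: 'I_n].

(** Through this map, refinement and equality of partitions become equations ([refines_mnP],
    [part_mn_inj]). *)
Definition mn P p : 'I_n := [arg min_(q < p in pblock P p) val q].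

Definition mins P : {set 'I_n} := [set p | mn P p == p].

Section OnePartition.
Variable P : {set {set 'I_n}}.
Hypothesis pP : is_part P.

Let tiP : trivIset P. Proof. by case/and3P: pP. Qed.

Lemma cover_part p : p \in cover P.
Proof. by rewrite (cover_partition pP) inE. Qed.

Lemma mem_block p : p \in pblock P p.
Proof. by rewrite mem_pblock cover_part. Qed.

Lemma mn_in p : mn P p \in pblock P p.
Proof. by rewrite /mn; case: arg_minnP => //; apply: mem_block. Qed.

Lemma mn_min p q : q \in pblock P p -> mn P p <= q.
Proof. by rewrite /mn; case: arg_minnP => [|m _ h]; [apply: mem_block|apply: h]. Qed.

Lemma mn_le p : mn P p <= p.
Proof. exact/mn_min/mem_block. Qed.

Lemma mn_eq p q : (mn P p == mn P q) = (q \in pblock P p).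
Proof.
apply/eqP/idP => [e|qp].
  have := mn_in q; rewrite -e => h; have := mn_in p => h'.
  by rewrite -(same_pblock tiP h') (same_pblock tiP h) mem_block.
have e := same_pblock tiP qp.
by apply/val_inj/eqP; rewrite eqn_leq !mn_min // -?e ?mn_in // e mn_in.
Qed.

Lemma mn_idem p : mn P (mn P p) = mn P p.
Proof. by apply/esym/eqP; rewrite mn_eq mn_in. Qed.

Lemma mn_mins p : mn P p \in mins P.
Proof. by rewrite inE mn_idem. Qed.

Lemma card_mins : #|mins P| = #|P|.
Proof.
have e : pblock P @: mins P = P.
  apply/setP=> B; apply/imsetP/idP => [[p _ ->]|BP].
    by rewrite pblock_mem ?cover_part.
  have /set0Pn[b bB] := partition_neq0 pP BP.
  exists (mn P b); rewrite ?mn_mins //.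
  by rewrite (same_pblock tiP (mn_in b)) (def_pblock tiP BP bB).
rewrite -[in RHS]e card_in_imset // => p q; rewrite !inE => /eqP mp /eqP mq pq.
by rewrite -mp -mq; apply/eqP; rewrite mn_eq pq mem_block.
Qed.

End OnePartition.

Lemma refines_mnP P Q : is_part P -> is_part Q ->
  reflect (forall p, mn Q (mn P p) = mn Q p) (refines P Q).
Proof.
move=> pP pQ; have [tiP tiQ] : trivIset P /\ trivIset Q.
  by case/and3P: pP; case/and3P: pQ.
apply: (iffP forall_inP) => [rPQ p|h A AP].
  have /rPQ/exists_inP[B BQ /subsetP sB] : pblock P p \in P.
    by rewrite pblock_mem ?cover_part.
  have e := def_pblock tiQ BQ (sB _ (mem_block pP p)).
  by apply/esym/eqP; rewrite mn_eq // e sB ?mn_in.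
have /set0Pn[a aA] := partition_neq0 pP AP.
apply/exists_inP; exists (pblock Q a); first by rewrite pblock_mem ?cover_part.
apply/subsetP=> b bA; rewrite -mn_eq //; apply/eqP.
rewrite -(h a) -(h b); congr mn; apply/eqP.
by rewrite mn_eq // (def_pblock tiP AP aA).
Qed.

Lemma part_mn_inj P Q : is_part P -> is_part Q -> mn P =1 mn Q -> P = Q.
Proof.
move=> pP pQ e; have [tiP tiQ] : trivIset P /\ trivIset Q.
  by case/and3P: pP; case/and3P: pQ.
have h p : pblock P p = pblock Q p.
  by apply/setP=> q; rewrite -!mn_eq // !e.
apply/setP=> B; apply/idP/idP => BP.
  have /set0Pn[b bB] := partition_neq0 pP BP.
  by rewrite -(def_pblock tiP BP bB) h pblock_mem ?cover_part.
have /set0Pn[b bB] := partition_neq0 pQ BP.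
by rewrite -(def_pblock tiQ BP bB) -h pblock_mem ?cover_part.
Qed.

Definition part_of (m : 'I_n -> 'I_n) := preim_partition m [set: 'I_n].

Lemma part_of_part m : is_part (part_of m).
Proof. exact: preim_partitionP. Qed.

(** Each fibre of m contains its value, which is its least element. New partitions are constructed
    below by giving such a map. *)
Lemma mn_part_of m : (forall p, m (m p) = m p) -> (forall p, m p <= p) ->
  mn (part_of m) =1 m.
Proof.
move=> mm lem p; have pM := part_of_part m.
have E q r : (r \in pblock (part_of m) q) = (m q == m r).
  by rewrite pblock_equivalence_partition ?inE // => x y z _ _ _; split=> // /eqP->.
apply/val_inj/eqP; rewrite eqn_leq mn_min ?E ?mm //=.
by have := mn_in pM p; rewrite E => /eqP->.
Qed.

Lemma refines_mins P Q : is_part P -> is_part Q -> refines P Q ->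
  mins Q \subset mins P.
Proof.
move=> pP pQ /(refines_mnP pP pQ) h; apply/subsetP=> q; rewrite !inE => /eqP qQ.
apply/eqP/val_inj/eqP; rewrite eqn_leq mn_le //= -{1}qQ -(h q).
exact: mn_le.
Qed.

Lemma refines_mins_eq P Q : is_part P -> is_part Q -> refines P Q ->
  mins P = mins Q -> P = Q.
Proof.
move=> pP pQ /(refines_mnP pP pQ) h e; apply: part_mn_inj => // p.
by have := mn_mins pP p; rewrite e inE h => /eqP.
Qed.

Lemma refinesT P Q R : is_part P -> is_part Q -> is_part R ->
  refines P Q -> refines Q R -> refines P R.
Proof.
move=> pP pQ pR /(refines_mnP pP pQ) h1 /(refines_mnP pQ pR) h2.
by apply/refines_mnP => // p; rewrite -h2 h1 h2.
Qed.

Lemma refines_refl P : refines P P.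
Proof. by apply/forall_inP=> A AP; apply/exists_inP; exists A. Qed.

Lemma rank_part P : is_part P -> Pi_rank P = n - #|mins P|.
Proof. by move=> pP; rewrite card_mins. Qed.

Lemma card_mins_rank P : is_part P -> #|mins P| = n - Pi_rank P.
Proof.
by move=> pP; rewrite rank_part // subKn // -[n in _ <= n]card_ord max_card.
Qed.

Lemma refines_rank P Q : is_part P -> is_part Q -> refines P Q ->
  Pi_rank P <= Pi_rank Q.
Proof.
by move=> pP pQ /(refines_mins pP pQ)/subset_leq_card h; rewrite !rank_part ?leq_sub2l.
Qed.

Lemma refines_rank_eq P Q : is_part P -> is_part Q -> refines P Q ->
  Pi_rank P = Pi_rank Q -> P = Q.
Proof.
move=> pP pQ rPQ e; apply: (refines_mins_eq pP pQ rPQ); apply/eqP.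
by rewrite eq_sym eqEcard refines_mins //= (card_mins_rank pP) (card_mins_rank pQ) e.
Qed.

Lemma bot_part : is_part (Pi_bot n).
Proof.
apply/and3P; split.
- apply/eqP/setP=> x; rewrite inE; apply/bigcupP; exists [set x]; rewrite ?inE //.
  exact: imset_f.
- apply/trivIsetP=> _ _ /imsetP[x _ ->] /imsetP[y _ ->] neq.
  by rewrite disjoints1 inE; apply: contraNN neq => /eqP->.
- by apply/imsetP=> -[x _] /setP/(_ x); rewrite !inE eqxx.
Qed.

Lemma top_part : 0 < n -> is_part (Pi_top n).
Proof.
move=> n0; apply/and3P; split.
- by rewrite /cover big_set1.
- by apply/trivIsetP=> _ _ /set1P-> /set1P->; rewrite eqxx.
- by rewrite inE eq_sym -cards_eq0 cardsT card_ord -lt0n.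
Qed.

Lemma mn_bot p : mn (Pi_bot n) p = p.
Proof.
have pB := bot_part; have tiB : trivIset (Pi_bot n) by case/and3P: pB.
have := mn_in pB p; rewrite (@def_pblock _ _ [set p]) ?inE ?imset_f // => /eqP //.
Qed.

Lemma rank_bot : Pi_rank (Pi_bot n) = 0.
Proof.
by rewrite /Pi_rank card_imset ?card_ord ?subnn //; apply: set1_inj.
Qed.

Lemma rank_top : Pi_rank (Pi_top n) = n.-1.
Proof. by rewrite /Pi_rank cards1 subn1. Qed.

Lemma bot_refines P : is_part P -> refines (Pi_bot n) P.
Proof. by move=> pP; apply/refines_mnP=> // [|p]; rewrite ?mn_bot //; apply: bot_part. Qed.

Lemma refines_top P : refines P (Pi_top n).
Proof.
by apply/forall_inP=> A AP; apply/exists_inP; exists [set: 'I_n]; rewrite ?inE ?subsetT.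
Qed.

Lemma mins_top (n0 : 0 < n) p : (p \in mins (Pi_top n)) = (val p == 0).
Proof.
have pT := top_part n0; have tiT : trivIset (Pi_top n) by case/and3P: pT.
have E q : pblock (Pi_top n) q = setT.
  by apply: def_pblock => //; rewrite ?inE.
have le0 q : mn (Pi_top n) q <= 0.
  by apply: (@leq_trans (Ordinal n0)) => //; apply: mn_min => //; rewrite E inE.
rewrite inE; apply/eqP/eqP => [<-|p0]; first by apply/eqP; rewrite -leqn0 le0.
by apply/val_inj/eqP; rewrite /= p0 -leqn0 le0.
Qed.

Lemma mem_Pi_proper P : 2 < n ->
  is_part P -> 0 < Pi_rank P < n.-1 -> P \in Pi_proper n.
Proof.
move=> n2 pP rP; rewrite inE [partition _ _]pP /strictly_refines bot_refines //.
rewrite refines_top !andbT /=; apply/andP; split.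
  by apply: contraTneq rP => <-; rewrite rank_bot.
by apply: contraTneq rP => ->; rewrite rank_top ltnn andbF.
Qed.

Lemma Pi_proper_part P : P \in Pi_proper n -> is_part P.
Proof. by rewrite inE => /and3P[]. Qed.

End BlockMinima.

(** * Ascents between three nested partitions *)

Section Ascents.
Variable n : nat.
Implicit Types (P Q R W Y Z : {set {set 'I_n}}) (C : {set {set {set 'I_n}}}).
Implicit Types (p q a b : 'I_n).

(** Ascent at Z when a cover is labelled by the block minimum that it loses, extended to steps of
    any length. *)
Definition asc3 W Z Y := forall a b,
  a \in mins W -> a \notin mins Z -> b \in mins Z -> b \notin mins Y -> a < b.

Definition weight P := \sum_(a in mins P) val a.

(** If the minimum of the W-block of p were lost at Z and that of its Z-block at Y, the former would
    be smaller; but coarsening never raises a minimum. Hence W, Y and the minima of Z determine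
    Z. *)
Lemma asc3_mn W Z Y : is_part W -> is_part Z -> is_part Y ->
  refines W Z -> refines Z Y -> asc3 W Z Y -> forall p,
  mn Z p = if mn W p \in mins Z then mn W p else mn Y p.
Proof.
move=> pW pZ pY rWZ rZY h p.
have WZ := refines_mnP pW pZ rWZ p; have ZY := refines_mnP pZ pY rZY p.
case: ifPn => [|nWZ]; first by rewrite inE WZ => /eqP.
have [|nZY] := boolP (mn Z p \in mins Y); first by rewrite inE ZY => /eqP.
have := h _ _ (mn_mins pW p) nWZ (mn_mins pZ p) nZY.
by rewrite ltnNge -{1}WZ mn_le.
Qed.

Lemma asc3_unique W Z Z' Y : is_part W -> is_part Z -> is_part Z' -> is_part Y ->
  refines W Z -> refines Z Y -> refines W Z' -> refines Z' Y ->
  asc3 W Z Y -> mins Z = mins Z' -> Z = Z'.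
Proof.
move=> pW pZ pZ' pY WZ ZY WZ' ZY' h e; apply: part_mn_inj => // p.
rewrite (asc3_mn pW pZ pY WZ ZY h) (asc3_mn pW pZ' pY WZ' ZY') ?e //.
by rewrite /asc3 -e.
Qed.

Lemma sum_lt_sum (A B : {set 'I_n}) : #|A| = #|B| -> A != set0 ->
  (forall a b, a \in A -> b \in B -> b < a) -> \sum_(b in B) val b < \sum_(a in A) val a.
Proof.
move=> cAB A0 h; have /set0Pn[a0 a0A] := A0.
case: (arg_minnP val a0A) => m mA mmin.
have B0 : 0 < #|B| by rewrite -cAB card_gt0.
have /card_gt0P[b bB] := B0.
apply: (@leq_trans (\sum_(a in A) m)); last exact: leq_sum.
rewrite sum_nat_const cAB -sum_nat_const (bigD1 b) //= [X in _ < X](bigD1 b) //=.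
rewrite -addSn leq_add ?h // leq_sum // => c /andP[cB _].
by rewrite ltnW // h.
Qed.

(** A minimum of Z' but not of Z is lost between W and Z, a minimum of Z but not of Z' is lost
    between Z and Y. The ascent puts the former below the latter, and the two kinds are equally
    many. *)
Lemma asc3_weight W Z Z' Y : is_part W -> is_part Z -> is_part Z' -> is_part Y ->
  refines W Z -> refines Z Y -> refines W Z' -> refines Z' Y ->
  asc3 W Z Y -> Pi_rank Z' = Pi_rank Z -> Z' != Z -> weight Z' < weight Z.
Proof.
move=> pW pZ pZ' pY WZ ZY WZ' ZY' h rk ne.
have split (X V : {set {set 'I_n}}) : \sum_(a in mins X) val a =
   \sum_(a in mins X :&: mins V) val a + \sum_(a in mins X :\: mins V) val a.
  exact: big_setID.
have cZ : #|mins Z| = #|mins Z'| by rewrite !card_mins_rank ?rk.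
rewrite /weight (split Z' Z) (split Z Z') setIC ltn_add2l; apply: sum_lt_sum.
- by apply/eqP; rewrite -(eqn_add2l #|mins Z :&: mins Z'|) cardsID setIC cardsID cZ.
- apply: contra ne => AB0; apply/eqP/esym.
  apply: (asc3_unique pW pZ pZ' pY) => //; apply/eqP.
  by rewrite eqEcard cZ leqnn andbT -setD_eq0.
- move=> a b /setDP[aZ aZ'] /setDP[bZ' bZ]; apply: h => //.
    exact: (subsetP (refines_mins pW pZ' WZ')).
  by apply: contra aZ'; apply/subsetP/refines_mins.
Qed.

(** Among the minima of W that Y loses, Z drops the smallest ones, those below a threshold t. *)
Lemma asc3_exists W Y (r : nat) : is_part W -> is_part Y -> refines W Y ->
  Pi_rank W <= r <= Pi_rank Y ->
  exists Z, [/\ is_part Z, refines W Z, refines Z Y, Pi_rank Z = r & asc3 W Z Y].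
Proof.
move=> pW pY rWY /andP[rW rY].
have WY := refines_mnP pW pY rWY.
pose M t := mins Y :|: [set a in mins W | t <= a].
have inM t a : (a \in M t) = (a \in mins Y) || (a \in mins W) && (t <= a).
  by rewrite in_setU; congr (_ || _); rewrite in_set.
(* The future [mn Z]: points of W-blocks with minimum below t are sent to the minimum of their
   Y-block. *)
pose m t p := if mn W p < t then mn Y p else mn W p.
(* The size of [M t] passes from at least n - r at t = 0 to at most n - r at t = n, dropping by at
   most 1 at each step. *)
have [t ct] : exists t, #|M t| = n - r.
  have cn : n - r <= #|M 0|.
    apply: (@leq_trans #|mins W|); first by rewrite card_mins_rank // leq_sub2l.
    by apply: subset_leq_card; apply/subsetP=> a aW; rewrite inM aW orbT.
  have c0 : #|M n| <= n - r.
    apply: (@leq_trans #|mins Y|); last by rewrite card_mins_rank // leq_sub2l.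
    apply: subset_leq_card; apply/subsetP=> a; rewrite inM => /orP[//|].
    by rewrite leqNgt ltn_ord andbF.
  have step t : #|M t| <= #|M t.+1|.+1.
    have [tn|nt] := ltnP t n.
      have -> : #|M t.+1|.+1 = (#|M t.+1| + #|[set Ordinal tn]|)%N by rewrite cards1 addn1.
      apply: leq_trans (leq_card_setU _ _); apply: subset_leq_card.
      apply/subsetP=> a; rewrite in_setU !inM in_set1 => /orP[-> //|/andP[-> /=]].
      rewrite leq_eqVlt => /orP[/eqP ta|->]; last by rewrite orbT.
      by rewrite -val_eqE /= -ta eqxx orbT.
    apply: leqW; apply: subset_leq_card; apply/subsetP=> a; rewrite !inM.
    by rewrite [t <= a]leqNgt (leq_trans (ltn_ord a)) // andbF orbF => ->.
  case: (@ex_minnP (fun t => #|M t| <= n - r)); first by exists n.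
  case=> [|t] le mint; first by exists 0; apply/eqP; rewrite eqn_leq le.
  exists t.+1; apply/eqP; rewrite eqn_leq le /=.
  rewrite -ltnS; apply: leq_trans (step t).
  by rewrite ltnNge; apply/negP=> /mint; rewrite ltnn.
have leYW p : mn Y p <= mn W p by rewrite -WY mn_le.
have WmY p : mn W (mn Y p) = mn Y p.
  apply/val_inj/eqP; rewrite eqn_leq mn_le //=.
  by rewrite -{1}(mn_idem pY p) -WY mn_le.
have mm p : m t (m t p) = m t p.
  rewrite {2 3}/m; case: ifP => c; rewrite /m.
    by rewrite WmY (leq_ltn_trans (leYW p) c) mn_idem.
  by rewrite mn_idem // c.
have lem p : m t p <= p by rewrite /m; case: ifP => _; apply: mn_le.
have eZ := mn_part_of mm lem.
have minsZ : mins (part_of (m t)) = M t.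
  apply/setP=> p; rewrite inM !inE eZ /m; case: ltnP => c.
    apply/idP/orP=> [->|[//|/andP[/eqP e]]]; first by left.
    by rewrite -{1}e leqNgt c.
  apply/idP/orP=> [/eqP e|[/eqP e|/andP[]//]]; first by right; rewrite e eqxx /= -e.
  by rewrite -[X in mn W X]e WmY e.
have pZ := part_of_part (m t).
exists (part_of (m t)); split=> //.
- apply/(refines_mnP pW pZ) => p; rewrite !eZ /m mn_idem //.
  by case: ifP; rewrite ?WY.
- by apply/(refines_mnP pZ pY) => p; rewrite eZ /m; case: ifP => _; rewrite ?(mn_idem pY) ?WY.
- rewrite rank_part // minsZ ct subKn //; apply: leq_trans rY _.
  exact: leq_subr.
- move=> a b aW; rewrite minsZ !inM !negb_or aW /= -ltnNge => /andP[_ at_].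
  by case/orP=> [-> //|/andP[_ tb] _]; apply: leq_trans at_ tb.
Qed.

End Ascents.

(** * Chains and their descents *)

Section Chains.
Variable n : nat.
Hypothesis n2 : 2 < n.
Implicit Types (P Q R W Y Z : {set {set 'I_n}}) (C : {set {set {set 'I_n}}}).
Implicit Types (p q a b r : 'I_n) (S T U : {set 'I_n}).

Let n0 : 0 < n. Proof. exact: leq_trans n2. Qed.

Lemma Pi_rank_lt P : is_part P -> Pi_rank P < n.
Proof.
move=> pP; rewrite rank_part // ltn_subrL n0 andbT card_gt0.
by apply/set0Pn; exists (mn P (Ordinal n0)); apply: mn_mins.
Qed.

Lemma rank_ord_inj P (r s : 'I_n) : Pi_rank P = r -> Pi_rank P = s -> r = s.
Proof. by move=> er es; apply/val_inj; rewrite /= -er -es. Qed.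

Definition ranked U P := [exists r in U, Pi_rank P == r].

Lemma rankedE U P r : Pi_rank P = r -> ranked U P = (r \in U).
Proof.
move=> e; apply/exists_inP/idP => [[s sU]|rU]; last by exists r; rewrite ?e.
by rewrite e => /eqP/val_inj->.
Qed.

Definition restr U C := [set P in C | ranked U P].

Lemma restrS U T C : U \subset T -> restr U (restr T C) = restr U C.
Proof.
move=> UT; apply/setP=> P; rewrite !inE -andbA; congr (_ && _).
apply: andb_idl => /exists_inP[r rU e]; apply/exists_inP.
by exists r => //; apply: (subsetP UT).
Qed.

Section OneChain.
Variables (T : {set 'I_n}) (C : {set {set {set 'I_n}}}).
Hypothesis CT : C \in chains T.

Lemma chain_proper P : P \in C -> P \in Pi_proper n.
Proof. by move: CT; rewrite inE => /andP[/andP[/subsetP h _] _]; apply: h. Qed.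

Lemma chain_part P : P \in C -> is_part P.
Proof. by move/chain_proper/Pi_proper_part. Qed.

Lemma chain_rank P : P \in C -> exists2 r, r \in T & Pi_rank P = r.
Proof.
move=> PC; have lt := Pi_rank_lt (chain_part PC); exists (Ordinal lt) => //.
move: CT; rewrite inE => /andP[_ /eqP<-]; rewrite inE; apply/exists_inP.
by exists P.
Qed.

Lemma chain_ex r : r \in T -> exists2 P, P \in C & Pi_rank P = r.
Proof.
move: CT; rewrite inE => /andP[_ /eqP<-]; rewrite inE => /exists_inP[P PC /eqP e].
by exists P.
Qed.

Lemma chain_refines P Q : P \in C -> Q \in C -> Pi_rank P <= Pi_rank Q -> refines P Q.
Proof.
move=> PC QC le; have pP := chain_part PC; have pQ := chain_part QC.
move: CT; rewrite inE => /andP[/andP[_ /forall_inP/(_ P PC)/forall_inP/(_ Q QC) h] _].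
case/orP: h => // rQP; have h := refines_rank pQ pP rQP.
rewrite (refines_rank_eq pQ pP rQP) ?refines_refl //.
by apply/eqP; rewrite eqn_leq h.
Qed.

Lemma chain_rank_inj P Q : P \in C -> Q \in C -> Pi_rank P = Pi_rank Q -> P = Q.
Proof.
move=> PC QC e; apply: refines_rank_eq => //; rewrite ?(chain_part PC) ?(chain_part QC) //.
by rewrite chain_refines ?e.
Qed.

Lemma chain_mins P Q : P \in C -> Q \in C -> Pi_rank P <= Pi_rank Q ->
  mins Q \subset mins P.
Proof. by move=> PC QC /(chain_refines PC QC); apply: refines_mins; apply: chain_part. Qed.

Lemma restr_chains U : U \subset T -> restr U C \in chains U.
Proof.
move=> UT; rewrite inE; apply/andP; split.
  apply/andP; split; first by apply/subsetP=> P; rewrite inE => /andP[/chain_proper].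
  apply/forall_inP=> P; rewrite inE => /andP[PC _].
  apply/forall_inP=> Q; rewrite inE => /andP[QC _].
  by have /orP[] := leq_total (Pi_rank P) (Pi_rank Q) => /chain_refines-> //; rewrite orbT.
apply/eqP/setP=> r; rewrite inE; apply/exists_inP/idP => [[P]|rU].
  by rewrite inE => /andP[PC rkP] /eqP e; rewrite -(rankedE U e).
have [P PC e] := chain_ex (subsetP UT r rU).
by exists P; rewrite ?e // inE PC (rankedE U e).
Qed.

Lemma restr_id : restr T C = C.
Proof.
apply/setP=> P; rewrite inE; apply: andb_idr => /chain_rank[r rT e].
by rewrite (rankedE T e).
Qed.

Lemma restrD1 r Z : Z \in C -> Pi_rank Z = r -> restr (T :\ r) C = C :\ Z.
Proof.
move=> ZC e; apply/setP=> P; rewrite !inE andbC; case PC: (P \in C); rewrite ?andbF ?andbT //.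
have [s sT es] := chain_rank PC; rewrite (rankedE _ es) !inE sT andbT; congr negb.
apply/eqP/eqP => [esr|eP]; first by apply: chain_rank_inj; rewrite // es esr.
by apply/val_inj; rewrite /= -es eP.
Qed.

Lemma insert_chains r Z : r \notin T -> is_part Z -> Pi_rank Z = r -> 0 < r < n.-1 ->
  (forall P, P \in C -> refines P Z || refines Z P) ->
  [/\ Z |: C \in chains (r |: T), restr T (Z |: C) = C & Z \notin C].
Proof.
move=> rT pZ eZ br cmp.
have ZC : Z \notin C.
  by apply: contra rT => /chain_rank[s sT e]; rewrite (rank_ord_inj eZ e).
split=> //.
  rewrite inE; apply/andP; split.
    apply/andP; split.
      apply/subsetP=> P /setU1P[->|/chain_proper//].
      by rewrite mem_Pi_proper ?eZ.
    apply/forall_inP=> P /setU1P[->|PC]; apply/forall_inP=> Q /setU1P[->|QC].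
    - by rewrite refines_refl.
    - by rewrite orbC cmp.
    - by rewrite cmp.
    - by have /orP[] := leq_total (Pi_rank P) (Pi_rank Q) => /chain_refines-> //; rewrite orbT.
  apply/eqP/setP=> s; rewrite inE; apply/exists_inP/idP => [[P]|].
    rewrite in_setU1 => /orP[/eqP->|PC] /eqP e; apply/setU1P; [left|right].
      exact: rank_ord_inj e eZ.
    by have [t tT et] := chain_rank PC; rewrite (rank_ord_inj e et).
  case/setU1P=> [->|/chain_ex[P PC e]]; first by exists Z; rewrite ?setU11 ?eZ.
  by exists P; rewrite ?e // setU1r.
apply/setP=> P; rewrite !inE; case: eqP => [->|_] /=; last first.
  apply: andb_idr => /chain_rank[s sT e]; by rewrite (rankedE T e).
by rewrite (rankedE T eZ) (negPf rT) (negPf ZC).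
Qed.

(** W is the last element of C of rank below r, or [Pi_bot] if there is none; the listed properties
    cover both cases at once. *)
Lemma chain_pred (r : nat) : 0 < r -> exists W, [/\ is_part W, Pi_rank W < r,
   (forall P, P \in C -> Pi_rank P < r -> refines P W),
   (forall P, is_part P -> (forall Q, Q \in C -> Pi_rank Q < r -> refines Q P) -> refines W P)
   & (forall a, (forall Q, Q \in C -> Pi_rank Q < r -> a \in mins Q) -> a \in mins W)].
Proof.
move=> r0; have [none|] := boolP [forall P in C, r <= Pi_rank P].
  exists (Pi_bot n); rewrite rank_bot; split=> //.
  - exact: bot_part.
  - by move=> P /(forall_inP none); rewrite leqNgt => /negPf->.
  - by move=> P pP _; apply: bot_refines.
  - by move=> a _; rewrite inE mn_bot.
case/forall_inPn=> P0 P0C; rewrite -ltnNge => P0r.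
have h0 : (P0 \in C) && (Pi_rank P0 < r) by rewrite P0C.
case: (@arg_maxnP _ P0 (fun P => (P \in C) && (Pi_rank P < r)) (@Pi_rank n) h0)
  => W /andP[WC Wr] Wmax; exists W; split=> //.
- exact: chain_part.
- by move=> P PC Pr; apply: chain_refines => //; apply: Wmax; rewrite PC.
- by move=> P pP; apply.
- by move=> a; apply.
Qed.

(** Dual to [chain_pred], with [Pi_top] as substitute; a must be nonzero because [Pi_top] still has
    the minimum 0. *)
Lemma chain_succ (r : nat) : r < n.-1 -> exists Y, [/\ is_part Y, r < Pi_rank Y,
   (forall P, P \in C -> r < Pi_rank P -> refines Y P),
   (forall P, is_part P -> (forall Q, Q \in C -> r < Pi_rank Q -> refines P Q) -> refines P Y)
   & (forall a, 0 < a ->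
       (forall Q, Q \in C -> r < Pi_rank Q -> a \notin mins Q) -> a \notin mins Y)].
Proof.
move=> r0; have [none|] := boolP [forall P in C, Pi_rank P <= r].
  exists (Pi_top n); rewrite rank_top; split=> //.
  - exact: top_part.
  - by move=> P /(forall_inP none); rewrite leqNgt => /negPf->.
  - by move=> P pP _; apply: refines_top.
  - by move=> a a0 _; rewrite mins_top // -lt0n.
case/forall_inPn=> P0 P0C; rewrite -ltnNge => P0r.
have h0 : (P0 \in C) && (r < Pi_rank P0) by rewrite P0C.
case: (@arg_minnP _ P0 (fun P => (P \in C) && (r < Pi_rank P)) (@Pi_rank n) h0)
  => Y /andP[YC Yr] Ymin; exists Y; split=> //.
- exact: chain_part.
- by move=> P PC Pr; apply: chain_refines => //; apply: Ymin; rewrite PC.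
- by move=> P pP; apply.
- by move=> a _; apply.
Qed.

End OneChain.

(* If C is a chain, lower_mins C P and upper_mins C P are the block minima of *)
(* the predecessor and of the successor of P in C; Pi_bot and Pi_top stand in *)
(* for them at the ends, their sets of minima being everything and {0}.       *)
Definition lower_mins C P :=
  [set a | [forall W in C, (Pi_rank W < Pi_rank P) ==> (a \in mins W)]].

Definition upper_mins C P :=
  [set b : 'I_n | (b == 0 :> nat) ||
     [exists Y in C, (Pi_rank P < Pi_rank Y) && (b \in mins Y)]].

Lemma in_lower_mins C P a : (a \in lower_mins C P) =
  [forall W in C, (Pi_rank W < Pi_rank P) ==> (a \in mins W)].
Proof. by rewrite in_set. Qed.

Lemma in_upper_mins C P b : (b \in upper_mins C P) =
  (b == 0 :> nat) || [exists Y in C, (Pi_rank P < Pi_rank Y) && (b \in mins Y)].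
Proof. by rewrite in_set. Qed.

(** The condition [asc3] at P between its two neighbours in C. *)
Definition asc C P :=
  [forall a in lower_mins C P :\: mins P, forall b in mins P :\: upper_mins C P, a < b].

Lemma ascP C P : reflect (forall a b,
  (forall W, W \in C -> Pi_rank W < Pi_rank P -> a \in mins W) -> a \notin mins P ->
  b \in mins P -> 0 < b ->
  (forall Y, Y \in C -> Pi_rank P < Pi_rank Y -> b \notin mins Y) -> a < b) (asc C P).
Proof.
apply: (iffP forall_inP) => [h a b ha aP bP b0 hb|h a].
  have /forall_inP h' : [forall b in mins P :\: upper_mins C P, a < b].
    apply: h; rewrite in_setD aP in_lower_mins; apply/forall_inP=> W WC.
    by apply/implyP; apply: ha.
  apply: h'; rewrite in_setD bP andbT in_upper_mins negb_or -lt0n b0 /=.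
  by apply/exists_inP => -[Y YC /andP[YP]]; apply/negP/hb.
rewrite in_setD in_lower_mins => /andP[aP /forall_inP ha]; apply/forall_inP=> b.
rewrite in_setD in_upper_mins negb_or -lt0n => /andP[/andP[b0 /exists_inPn hb] bP].
apply: h => // [W WC|Y YC]; first exact/implyP/ha.
by have := hb Y YC; rewrite negb_and => /orP[/negPf->|].
Qed.

Lemma mins_0 P a : is_part P -> a = 0 :> nat -> a \in mins P.
Proof.
move=> pP a0; rewrite inE; apply/eqP/val_inj/eqP.
by have := mn_le pP a; rewrite /= a0 leqn0.
Qed.

Lemma mins_strict P Q : is_part P -> is_part Q -> Pi_rank P < Pi_rank Q ->
  exists2 b, b \in mins P & b \notin mins Q.
Proof.
move=> pP pQ lt; have /subsetPn[b bP bQ] : ~~ (mins P \subset mins Q).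
  apply: contraL lt => /subset_leq_card; rewrite -leqNgt => le.
  by rewrite !rank_part // leq_sub2l.
by exists b.
Qed.

(* If A, B, D are the sets of minima lost in three consecutive steps and      *)
(* A < B < D elementwise, then A < D because B is not empty.                  *)
Lemma asc_del T C Z P : C \in chains T -> Z \in C -> P \in C -> P != Z ->
  asc C Z -> asc C P -> asc (C :\ Z) P.
Proof.
move=> CT ZC PC neq /ascP aZ /ascP aP; apply/ascP=> a b ha naP bP b0 hb.
have pZ := chain_part CT ZC; have pP := chain_part CT PC.
have ha' W : W \in C -> W != Z -> Pi_rank W < Pi_rank P -> a \in mins W.
  by move=> WC neW; apply: ha; rewrite in_setD1 neW.
have hb' Y : Y \in C -> Y != Z -> Pi_rank P < Pi_rank Y -> b \notin mins Y.
  by move=> YC neY; apply: hb; rewrite in_setD1 neY.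
have sub := chain_mins CT.
case: (ltngtP (Pi_rank Z) (Pi_rank P)) => [ZP|PZ|/(chain_rank_inj CT ZC PC) e]; last first.
- by rewrite e eqxx in neq.
- have [bZ|bZ] := boolP (b \in mins Z); last first.
    apply: aP => // [W WC WP|Y YC PY].
      by apply: ha' => //; apply: contraTneq WP => ->; rewrite -leqNgt ltnW.
    by have [->//|neY] := eqVneq Y Z; apply: hb'.
  (* Since b is a minimum of Z but of no other later element, Z directly follows P ([mid]). A
     minimum b' lost between them gives a < b' < b. The remaining case, with Z directly before P, is
     dual. *)
  have [b' b'P b'Z] := mins_strict pP pZ PZ.
  have mid W : W \in C -> Pi_rank P < Pi_rank W -> Pi_rank W < Pi_rank Z -> False.
    move=> WC PW WZ; have neW : W != Z by apply: contraTneq WZ => ->; rewrite ltnn.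
    by have /negP[] := hb' W WC neW PW; apply: (subsetP (sub _ _ WC ZC (ltnW WZ))).
  apply: (@ltn_trans b').
    apply: aP => // [W WC WP||Y YC PY].
    + by apply: ha' => //; apply: contraTneq WP => ->; rewrite -leqNgt ltnW.
    + by rewrite lt0n; apply: contra b'Z => /eqP; apply: mins_0.
    + apply: contra b'Z; apply/subsetP/sub => //.
      by rewrite leqNgt; apply/negP; apply: mid.
  apply: aZ => // [W WC WZ|Y YC ZY].
    apply: (subsetP (sub _ _ WC PC _)) => //; rewrite leqNgt; apply/negP => PW.
    exact: (mid W).
  by apply: hb' (ltn_trans PZ ZY) => //; apply: contraTneq ZY => ->; rewrite ltnn.
have [aZ'|aZ'] := boolP (a \in mins Z).
  apply: aP => // [W WC WP|Y YC PY].
    by have [->//|neW] := eqVneq W Z; apply: ha'.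
  by apply: hb' => //; apply: contraTneq PY => ->; rewrite -leqNgt ltnW.
have [b' b'Z b'P] := mins_strict pZ pP ZP.
have mid W : W \in C -> Pi_rank Z < Pi_rank W -> Pi_rank W < Pi_rank P -> False.
  move=> WC ZW WP; have neW : W != Z by apply: contraTneq ZW => ->; rewrite ltnn.
  by move: aZ'; rewrite (subsetP (sub _ _ ZC WC (ltnW ZW)) a) // ha'.
apply: (@ltn_trans b').
  apply: aZ => // [W WC WZ||Y YC ZY].
  - by apply: ha' (ltn_trans WZ ZP) => //; apply: contraTneq WZ => ->; rewrite ltnn.
  - by rewrite lt0n; apply: contra b'P => /eqP; apply: mins_0.
  - apply: contra b'P; apply/subsetP/sub => //.
    by rewrite leqNgt; apply/negP; apply: mid.
apply: aP => // [W WC WP|Y YC PY].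
  apply: (subsetP (sub _ _ WC ZC _)) => //; rewrite leqNgt; apply/negP => ZW.
  exact: (mid W).
by apply: hb' => //; apply: contraTneq PY => ->; rewrite -leqNgt ltnW.
Qed.

(** The elements with rank outside T are ascents; [asc_del] removes them one at a time and keeps all
    other ascents. *)
Lemma asc_restr S T C P : C \in chains S -> T \subset S ->
  (forall Q, Q \in C -> ~~ ranked T Q -> asc C Q) ->
  P \in restr T C -> asc C P -> asc (restr T C) P.
Proof.
have [m] := ubnP #|S :\: T|; elim: m S C => // m IH S C /ltnSE cS CS TS aT PT aP.
have [ST|/subsetPn[r rS rT]] := boolP (S \subset T).
  by move: PT; rewrite (_ : T = S) ?(restr_id CS) //; apply/eqP; rewrite eqEsubset TS.
have [Z ZC eZ] := chain_ex CS rS.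
have eC := restrD1 CS ZC eZ.
have TS' : T \subset S :\ r by rewrite subsetD1 TS.
rewrite -(restrS C TS') in PT *.
have CS' := restr_chains CS (subD1set S r).
have nZ : ~~ ranked T Z by rewrite (rankedE T eZ).
have del Q : Q \in restr (S :\ r) C -> asc C Q -> asc (restr (S :\ r) C) Q.
  rewrite eC => /setD1P[neQ QC] aQ.
  exact: asc_del CS ZC QC neQ (aT _ ZC nZ) aQ.
have [PC' PT'] : P \in restr (S :\ r) C /\ ranked T P.
  by move: PT; rewrite in_set => /andP.
apply: IH CS' TS' _ PT (del P PC' aP) => [|Q QC nQ].
  move: cS; rewrite (cardsD1 r) !inE rT rS add1n; apply: leq_trans.
  by rewrite ltnS subset_leq_card //; apply/subsetP=> s; rewrite !inE => /and3P[-> -> ->].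
apply: (del Q QC); apply: aT nQ.
by move: QC; rewrite in_set => /andP[].
Qed.

Definition Weight C := \sum_(P in C) weight P.

(** The two chains differ only at rank r, so [asc3_weight] applies between the common neighbours W
    and Y of Z and Z'. *)
Lemma asc_max T C C' Z r : C \in chains T -> C' \in chains T ->
  Z \in C -> Pi_rank Z = r -> 0 < r < n.-1 -> asc C Z ->
  restr (T :\ r) C' = restr (T :\ r) C -> C' != C -> Weight C' < Weight C.
Proof.
move=> CT C'T ZC eZ /andP[r0 rn] /ascP aZ eR neC.
have rT : r \in T by have [s sT es] := chain_rank CT ZC; rewrite (rank_ord_inj eZ es).
have [Z' Z'C' eZ'] := chain_ex C'T rT.
have := eR; rewrite (restrD1 C'T Z'C' eZ') (restrD1 CT ZC eZ) => eD.
rewrite /Weight (big_setD1 _ ZC) (big_setD1 _ Z'C') /= eD ltn_add2r.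
have neZ : Z' != Z.
  by apply: contra neC => /eqP e; rewrite -(setD1K ZC) -(setD1K Z'C') eD e.
have C0T := restr_chains CT (subD1set T r); rewrite (restrD1 CT ZC eZ) in C0T.
have [W [pW rW Wle Wle' Wm]] := chain_pred C0T r0.
have [Y [pY rY Yge Yge' Ym]] := chain_succ C0T rn.
have pZ := chain_part CT ZC; have pZ' := chain_part C'T Z'C'.
have sub Q : Q \in C :\ Z -> Q \in C by case/setD1P.
have sub' Q : Q \in C :\ Z -> Q \in C' by rewrite -eD; case/setD1P.
apply: (asc3_weight pW pZ pZ' pY) => //; rewrite ?eZ ?eZ' //.
- by apply: Wle' => // Q /sub QC lt; apply: (chain_refines CT) => //; rewrite eZ ltnW.
- by apply: Yge' => // Q /sub QC lt; apply: (chain_refines CT) => //; rewrite eZ ltnW.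
- by apply: Wle' => // Q /sub' QC lt; apply: (chain_refines C'T) => //; rewrite eZ' ltnW.
- by apply: Yge' => // Q /sub' QC lt; apply: (chain_refines C'T) => //; rewrite eZ' ltnW.
move=> a b aW aZn bZ bY; apply: aZ => // [Q QC lt||Q QC lt].
- have QD : Q \in C :\ Z.
    by rewrite in_setD1 QC andbT; apply: contraTneq lt => ->; rewrite ltnn.
  apply: (subsetP (refines_mins _ pW (Wle Q QD _))) => //; first exact: (chain_part CT QC).
  by rewrite -eZ.
- by rewrite lt0n; apply: contra bY => /eqP; apply: mins_0.
have QD : Q \in C :\ Z.
  by rewrite in_setD1 QC andbT; apply: contraTneq lt => ->; rewrite ltnn.
apply: contra bY; apply/subsetP/refines_mins => //; first exact: (chain_part CT QC).
by apply: Yge; rewrite -?eZ.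
Qed.

Lemma insert_asc T C r : C \in chains T -> r \notin T -> 0 < r < n.-1 ->
  exists Z, [/\ Z |: C \in chains (r |: T), restr T (Z |: C) = C, Z \notin C,
               Pi_rank Z = r & asc (Z |: C) Z].
Proof.
move=> CT rT /andP[r0 rn].
have [W [pW rW Wle Wle' Wm]] := chain_pred CT r0.
have [Y [pY rY Yge Yge' Ym]] := chain_succ CT rn.
have WY : refines W Y.
  apply: Wle' => // Q QC Qr; apply: Yge' => [|R RC Rr]; first exact: (chain_part CT QC).
  by apply: (chain_refines CT) => //; apply: ltnW (ltn_trans Qr Rr).
have [|Z [pZ WZ ZY eZ aZ]] := @asc3_exists n W Y r pW pY WY.
  by rewrite (ltnW rW) (ltnW rY).
have cmp P : P \in C -> refines P Z || refines Z P.
  move=> PC; have pP := chain_part CT PC; case: (ltngtP (Pi_rank P) r) => [lt|gt|e].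
  - by rewrite (refinesT pP pW pZ) ?Wle.
  - by rewrite (refinesT pZ pY pP) ?orbT ?Yge.
  - have [s sT es] := chain_rank CT PC; case/negP: rT.
    by rewrite (rank_ord_inj e es).
have [] := insert_chains CT rT pZ eZ _ cmp; first by rewrite r0.
move=> h1 h2 h3; exists Z; split=> //; apply/ascP => a b ha aZn bZ b0 hb.
apply: aZ => //; [apply: Wm|apply: Ym] => // Q QC; rewrite -eZ.
  by apply: ha; rewrite setU1r.
by apply: hb; rewrite setU1r.
Qed.

(** Z is replaced by an element that is an ascent at the same rank, the unique maximizer by
    [asc_max]. *)
Lemma nonasc_improve T C Z r : C \in chains T -> Z \in C -> Pi_rank Z = r ->
  0 < r < n.-1 -> ~~ asc C Z ->
  exists C', [/\ C' \in chains T, restr (T :\ r) C' = restr (T :\ r) C & Weight C < Weight C'].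
Proof.
move=> CT ZC eZ br naZ.
have rT : r \in T by have [s sT es] := chain_rank CT ZC; rewrite (rank_ord_inj eZ es).
have C0T := restr_chains CT (subD1set T r); rewrite (restrD1 CT ZC eZ) in C0T.
have [|Z' [C'T eR nZ' eZ' aZ']] := insert_asc C0T _ br; first by rewrite !inE eqxx.
rewrite setD1K // in C'T.
have eR' : restr (T :\ r) (Z' |: C :\ Z) = restr (T :\ r) C by rewrite eR (restrD1 CT ZC eZ).
exists (Z' |: C :\ Z); split=> //.
apply: (asc_max C'T CT (setU11 _ _) eZ') => //.
apply: contra naZ => /eqP e; rewrite e.
by rewrite (chain_rank_inj C'T (setU11 _ _) (_ : Z \in _)) ?eZ // -?e // in aZ' *.
Qed.

Lemma chains_extend S T C : T \subset S -> (forall r, r \in S -> 0 < r < n.-1) ->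
  C \in chains T -> exists2 C', C' \in chains S & restr T C' = C.
Proof.
move=> + bS; have [m] := ubnP #|S :\: T|; elim: m T C => // m IH T C /ltnSE cS TS CT.
have [ST|/subsetPn[r rS rT]] := boolP (S \subset T).
  have eT : T = S by apply/eqP; rewrite eqEsubset TS.
  by exists C; rewrite -?eT // restr_id.
have [Z [C'T eR nZ _ _]] := insert_asc CT rT (bS r rS).
have [||C' C'S e] := IH _ _ _ _ C'T.
- move: cS; rewrite (cardsD1 r) !inE rT rS add1n; apply: leq_trans.
  rewrite ltnS subset_leq_card //; apply/subsetP=> s.
  by rewrite !inE negb_or -andbA => /and3P[-> -> ->].
- by rewrite subUset sub1set rS.
by exists C' => //; rewrite -eR -e restrS // subsetUr.
Qed.

End Chains.

(** * The multiplicity as the dimension of the invariant cycles *)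

(** Burnside: the character at g counts the fixed points of g, and their average is the number of
    orbits. *)
Lemma cfdot_perm_repr (gT : finGroupType) (G : {group gT}) (rT : finType)
    (to : {action gT &-> rT}) (X : {set rT}) (nXG : [acts G, on X | to]) :
  ('[cfRepr (perm_repr nXG), 1]_G = #|orbit to G @: X|%:R)%R.
Proof.
have G0 : (#|G|%:R != 0 :> algC)%R by rewrite pnatr_eq0 -lt0n cardG_gt0.
rewrite cfdotE; apply: (mulfI G0); rewrite mulrA divff // mul1r -natrM mulnC.
rewrite -(Frobenius_Cauchy nXG) natr_sum; apply: eq_bigr => g Gg.
rewrite cfun1E Gg conjC1 mulr1 cfunE Gg mulr1n /mxtrace.
under eq_bigr => i _ do rewrite mxE.
rewrite -(big_enum_val (fun x => (to x g == x)%:R : algC)%R) /= -natr_sum -sum1_card.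
rewrite big_mkcond [in RHS]big_mkcond /=; congr (_%:R)%R; apply: eq_bigr => x _.
rewrite in_setI; case: (x \in X) => //=.
by case: afix1P => [->|/eqP/negPf->]; rewrite ?eqxx.
Qed.

Section Keys.
Variable n : nat.
Hypothesis n2 : 2 < n.
Variable S : {set 'I_n}.
Hypothesis bS : forall r, r \in S -> 0 < r < n.-1.
Implicit Types (C : {set {set {set 'I_n}}}) (s : 'S_n) (H : {group 'S_n}) (T U : {set 'I_n}).

Lemma restr_act T C s : restr T (chain_act n C s) = chain_act n (restr T C) s.
Proof.
have rk P : ranked T (part_act n P s) = ranked T P by rewrite /ranked /Pi_rank card_part_act.
apply/setP=> P; rewrite inE; apply/andP/imsetP => [[/imsetP[Q QC ->]]|[Q]].
  by rewrite rk => rQ; exists Q; rewrite // inE QC.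
by rewrite inE => /andP[QC rQ] ->; rewrite rk; split=> //; apply: imset_f.
Qed.

Lemma chain_act_chains T C s : (chain_act n C s \in chains T) = (C \in chains T).
Proof. exact: (actsP (acts_chains T)). Qed.

Notation N := #|chains S|.

(** The row space of [fibmx (key H T)] consists of the H-invariant functions in F_T; the trivial
    group gives F_T itself. *)
Definition key H T (i : 'I_N) := orbit (chain_act n) H (restr T (enum_val i)).

Lemma key_coherent H : coherent (key H).
Proof.
move=> T U TU i j /orbit_eqP/orbitP[s sH e]; apply/orbit_eqP/orbitP; exists s => //.
by rewrite -(restrS (enum_val i) TU) -(restrS (enum_val j) TU) -e restr_act.
Qed.

Lemma orbit_trivg C : orbit (chain_act n) 1%G C = [set C].
Proof.
apply/setP=> D; rewrite in_set1; apply/orbitP/eqP => [[s /set1P-> <-]|->].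
  by rewrite act1.
by exists 1%g; rewrite ?set11 ?act1.
Qed.

Lemma key1E T i j : key 1%G T i = key 1%G T j -> restr T (enum_val i) = restr T (enum_val j).
Proof. by rewrite /key !orbit_trivg => /set1_inj. Qed.

Lemma key1_inj : injective (key 1%G S).
Proof. by move=> i j /key1E; rewrite !restr_id ?enum_valP //; apply: enum_val_inj. Qed.

(** Every orbit on [chains T] is a value of the key because chains with rank set T extend to rank
    set S. *)
Lemma rank_key H T : T \subset S ->
  \rank (fibmx (key H T)) = #|orbit (chain_act n) H @: chains T|.
Proof.
move=> TS; rewrite rank_fibmx; apply: eq_card => o; apply/imsetP/imsetP.
  case=> i _ ->; exists (restr T (enum_val i)) => //.
  by apply: restr_chains TS; rewrite ?enum_valP.
case=> C CT ->; have [C' C'S e] := chains_extend n2 TS bS CT.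
by exists (enum_rank_in C'S C'); rewrite // /key enum_rankK_in // e.
Qed.

Section ChainFunctions.
Local Open Scope ring_scope.

(** u as a function of the chain instead of its index, zero outside [chains S]. *)
Definition chain_fun (u : 'rV[rat]_N) C := \sum_(i | enum_val i == C) u 0 i.

Lemma chain_funE (u : 'rV[rat]_N) i : chain_fun u (enum_val i) = u 0 i.
Proof.
rewrite /chain_fun (eq_bigl (pred1 i)) ?big_pred1_eq // => j.
by rewrite /= (inj_eq enum_val_inj).
Qed.

Lemma sum_chain_fun (u : 'rV[rat]_N) (Q : pred {set {set {set 'I_n}}}) :
  \sum_(i | Q (enum_val i)) u 0 i = \sum_(C in chains S | Q C) chain_fun u C.
Proof.
by rewrite big_enum_val_cond; apply: eq_bigr => i _; rewrite chain_funE.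
Qed.

(** The vanishing sum over the orbit of c splits into the fibre sums over its members d. By
    invariance of u these are all equal, so each is 0 in characteristic 0. *)
Lemma prim_key_sub H T : (prim_mx (key H) T <= prim_mx (key 1%G) T)%MS.
Proof.
apply/row_subP=> i0; set u := row i0 _.
have /sub_prim_mxP[ku su] : (u <= prim_mx (key H) T)%MS by apply: row_sub.
apply/sub_prim_mxP; split=> [i j /key1E e|t tT o].
  by apply: ku; rewrite /key e.
have [/existsP[j /eqP <-]|] := boolP [exists i, key 1%G (T :\ t) i == o]; last first.
  by rewrite negb_exists => /forallP h; rewrite big_pred0 // => i; apply/negbTE.
pose s c := \sum_(C in chains S | restr (T :\ t) C == c) chain_fun u C.
set c := restr (T :\ t) (enum_val j).
rewrite (eq_bigl (fun i => restr (T :\ t) (enum_val i) == c)); last first.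
  by move=> i; rewrite /key !orbit_trivg (inj_eq set1_inj).
rewrite (sum_chain_fun u (fun C => restr (T :\ t) C == c)) -/(s c).
have s_act g : g \in H -> s (chain_act n c g) = s c.
  move=> gH; rewrite /s (reindex_inj (act_inj (chain_act n) g)) /=.
  apply: eq_big => [C|C /andP[CS _]].
    by rewrite chain_act_chains restr_act (inj_eq (act_inj (chain_act n) g)).
  have CS' : C \in chains S by rewrite chain_act_chains in CS.
  rewrite -(enum_rankK_in CS CS) -[in RHS](enum_rankK_in CS' CS') !chain_funE.
  by apply: ku; rewrite /key !enum_rankK_in // restr_act; apply/orbit_eqP/mem_orbit.
have := su t tT (orbit (chain_act n) H c).
rewrite (sum_chain_fun u (fun C => orbit (chain_act n) H (restr (T :\ t) C) ==
                               orbit (chain_act n) H c)).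
rewrite (partition_big (restr (T :\ t)) (mem (orbit (chain_act n) H c))) /=; last first.
  by move=> C /andP[_ /eqP/orbit_eqP].
rewrite (eq_bigr (fun=> s c)) => [|d dc].
  rewrite sumr_const => /eqP; rewrite mulrn_eq0 => /orP[|/eqP//].
  by rewrite cards_eq0 => /eqP/setP/(_ c); rewrite orbit_refl inE.
have /orbitP[g gH <-] := dc; rewrite -(s_act g gH); apply: eq_bigl => C.
rewrite -andbA; congr (_ && _); apply: andb_idl => /eqP->; apply/eqP/orbit_eqP.
exact: mem_orbit.
Qed.

Definition descents (i : 'I_N) : {set 'I_n} :=
  [set r in S | [exists P in enum_val i, (Pi_rank P == r) && ~~ asc (enum_val i) P]].

Lemma descentsP (i : 'I_N) (P : {set {set 'I_n}}) (r : 'I_n) :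
  P \in enum_val i -> Pi_rank P = r ->
  (r \in descents i) = ~~ asc (enum_val i) P.
Proof.
move=> PC e; have CS := enum_valP i.
have rS : r \in S by have [s sS es] := chain_rank n2 CS PC; rewrite (rank_ord_inj e es).
rewrite inE rS; apply/exists_inP/idP => [[Q QC /andP[/eqP eQ]]|nP].
  by rewrite (chain_rank_inj CS QC PC) ?e.
by exists P; rewrite // e eqxx.
Qed.

(* In the support of u, let C minimize the weight of its ranks in T and then  *)
(* maximize its total weight.  The second choice puts the descents of C in T; *)
(* by the first, an ascent at t in T would make u C the only value            *)
(* contributing to a vanishing fibre sum.                                     *)
Lemma prim_key1_separating T (u : 'rV[rat]_N) : T \subset S ->
  (u <= prim_mx (key 1%G) T)%MS -> (forall i, descents i = T -> u 0 i = 0) -> u = 0.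
Proof.
move=> TS /sub_prim_mxP[ku su] du.
have ku' i j : restr T (enum_val i) = restr T (enum_val j) -> u 0 i = u 0 j.
  by move=> e; apply: ku; rewrite /key e.
apply/rowP=> i0; rewrite mxE; apply/eqP; apply: contraT => ui0.
case: (@arg_minnP _ i0 (fun i => u 0 i != 0) (fun i => Weight (restr T (enum_val i))) ui0).
move=> i1 ui1 min1.
case: (@arg_maxnP _ i1 (fun i => restr T (enum_val i) == restr T (enum_val i1))
        (fun i => Weight (enum_val i)) (eqxx _)) => i /eqP ei max.
have ui : u 0 i != 0 by rewrite (ku' _ _ ei).
have CS := enum_valP i; set C := enum_val i in CS ei max.
have index (D : {set {set {set 'I_n}}}) : D \in chains S -> {j : 'I_N | enum_val j = D}.
  by move=> DS; exists (enum_rank_in DS D); rewrite enum_rankK_in.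
have dT : descents i \subset T.
  apply/subsetP=> r rd; apply: contraT => rT.
  have rS : r \in S by move: rd; rewrite inE => /andP[].
  have [P PC e] := chain_ex CS rS.
  have nP : ~~ asc C P by rewrite -(descentsP PC e).
  have [C' [C'S eR lt]] := nonasc_improve n2 CS PC e (bS rS) nP.
  have [j ej] := index C' C'S.
  have TSr : T \subset S :\ r by rewrite subsetD1 TS.
  have := max j; rewrite ej -(restrS C' TSr) eR restrS // ei eqxx => /(_ isT).
  by rewrite /= leqNgt lt.
have [t tT td] : exists2 t, t \in T & t \notin descents i.
  apply/subsetPn; apply: contra ui => Td; rewrite du //.
  by apply/eqP; rewrite eqEsubset dT.
have tS := subsetP TS t tT; have [P PC e] := chain_ex CS tS.
have aP : asc (restr T C) P.
  apply: (asc_restr n2 CS TS).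
  - move=> Q QC nQ; have [r rS er] := chain_rank n2 CS QC.
    apply/negPn; rewrite -(descentsP QC er); apply: contra nQ => /(subsetP dT).
    by rewrite (rankedE T er).
  - by rewrite inE PC (rankedE T e).
  - by apply/negPn; rewrite -(descentsP PC e).
have := su t tT (key 1%G (T :\ t) i).
(* On chains agreeing with C on T, u has the constant value [u 0 i]. The other chains of the fibre
   have smaller weight on T by [asc_max], so u vanishes there by the first choice. *)
rewrite (bigID (fun j => restr T (enum_val j) == restr T C)) /=.
rewrite [X in _ + X]big1 ?addr0 => [|j /andP[/eqP/key1E ej nej]].
  rewrite (eq_bigr (fun=> u 0 i)) => [|j /andP[_ /eqP/ku'->//]].
  rewrite sumr_const => /eqP; rewrite mulrn_eq0 (negPf ui) orbF.
  by move/eqP/card0_eq/(_ i); rewrite unfold_in !eqxx.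
apply/eqP; apply: contraT => uj; have := min1 j uj; rewrite -ei leqNgt => /negP[].
have jS := enum_valP j; have TtT := subD1set T t.
apply: (asc_max n2 (restr_chains CS TS) (restr_chains jS TS) _ e (bS tS) aP) => //.
  by rewrite inE PC (rankedE T e).
by rewrite !restrS.
Qed.

Lemma b_mult_rank : b_mult S = (\rank (prim_mx (key [set: 'S_n]%G) S))%:R.
Proof.
rewrite -(@moebius_rank_fibmx _ _ _ _ _ _ descents (@key_coherent 1%G) key1_inj
  prim_key1_separating (@key_coherent _) (fun T _ => prim_key_sub _ T)).
rewrite /b_mult /beta cfdot_suml; apply: eq_bigr => T TS.
by rewrite cfdotZl cfdot_perm_repr rank_key.
Qed.

End ChainFunctions.
End Keys.

(** * An invariant cycle *)

Section IntervalPartitions.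
Variable n : nat.
Hypothesis n2 : 2 < n.
Implicit Types (A B : {set 'I_n}) (p q r : 'I_n).

Let n0 : 0 < n. Proof. exact: leq_trans n2. Qed.
Let z0 : 'I_n := Ordinal n0.

(** The left ends of the intervals. *)
Definition stops A := z0 |: ~: A.

Definition floor A p : 'I_n := [arg max_(q > z0 | (q \in stops A) && (q <= p)) val q].

Lemma floorP A p : [/\ floor A p \in stops A, floor A p <= p
  & forall q, q \in stops A -> q <= p -> q <= floor A p].
Proof.
rewrite /floor; case: arg_maxnP => [|q /andP[qA qp] h]; first by rewrite setU11.
by split=> // r rA rp; apply: h; rewrite rA.
Qed.

Lemma floor_id A p : p \in stops A -> floor A p = p.
Proof.
have [_ le h] := floorP A p => pA.
by apply/val_inj/eqP; rewrite eqn_leq le h.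
Qed.

Definition iota_part A := part_of (floor A).

Lemma iota_is_part A : is_part (iota_part A).
Proof. exact: part_of_part. Qed.

Lemma mn_iota A : mn (iota_part A) =1 floor A.
Proof.
apply: mn_part_of => p; have [h1 h2 _] := floorP A p => //.
exact: floor_id.
Qed.

Lemma mins_iota A : mins (iota_part A) = stops A.
Proof.
apply/setP=> p; rewrite [in LHS]in_set mn_iota; apply/eqP/idP => [<-|/floor_id//].
by have [] := floorP A p.
Qed.

Lemma rank_iota A : z0 \in A -> Pi_rank (iota_part A) = #|A|.-1.
Proof.
move=> zA; rewrite rank_part ?iota_is_part // mins_iota /stops cardsU1.
rewrite in_setC zA /= -[n in n - _]card_ord -(cardsC A) [#|A|](cardsD1 z0) zA.
by rewrite !add1n /= addSnnS addnK.
Qed.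

Lemma iota_refines A B : A \subset B -> refines (iota_part A) (iota_part B).
Proof.
move=> AB; apply/refines_mnP; rewrite ?iota_is_part // => p; rewrite !mn_iota.
have sub : stops B \subset stops A by rewrite setUS // setCS.
have [_ le1 h1] := floorP A p; have [i2 le2 h2] := floorP B p.
have [i3 le3 h3] := floorP B (floor A p).
apply/val_inj/eqP; rewrite eqn_leq h2 ?(leq_trans le3) //= h3 // h1 //.
exact: (subsetP sub).
Qed.

Definition initseg r : {set 'I_n} := [set p : 'I_n | p <= r].

Lemma card_initseg r : #|initseg r| = r.+1.
Proof.
have -> : initseg r = widen_ord (ltn_ord r) @: [set: 'I_r.+1].
  apply/setP=> p; rewrite in_set; apply/idP/imsetP => [pr|[i _ ->]].
    have pr' : p < r.+1 by [].
    by exists (Ordinal pr'); rewrite ?inE //; apply/val_inj.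
  by rewrite /= -ltnS ltn_ord.
by rewrite card_imset ?cardsT ?card_ord // => i j /(congr1 val) e; apply: val_inj.
Qed.

(** An S_n-invariant property by which images of the chain of the I_s are recognized. *)
Definition one_big_block (P : {set {set 'I_n}}) :=
  [forall A in P, forall B in P, (1 < #|A|) && (1 < #|B|) ==> (A == B)].

Lemma one_big_block_act P (s : 'S_n) :
  one_big_block P -> one_big_block (part_act n P s).
Proof.
move=> /forall_inP h; apply/forall_inP=> _ /imsetP[A AP ->].
apply/forall_inP=> _ /imsetP[B BP ->]; rewrite !card_setact.
by have /forall_inP/(_ B BP)/implyP h' := h A AP; apply/implyP=> /h'/eqP->.
Qed.

Lemma one_big_block_initseg r : one_big_block (iota_part (initseg r)).
Proof.
have pI := iota_is_part (initseg r).
have tiI : trivIset (iota_part (initseg r)) by case/and3P: pI.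
have key A : A \in iota_part (initseg r) -> 1 < #|A| -> A = pblock (iota_part (initseg r)) z0.
  move=> AP /card_gt1P[a [b [aA bA ab]]].
  have e := def_pblock tiI AP aA.
  have fab : floor (initseg r) a = floor (initseg r) b.
    by rewrite -!mn_iota; apply/eqP; rewrite mn_eq // e.
  have [c [cA nc]] : exists c, c \in A /\ floor (initseg r) c != c.
    have [ea|] := eqVneq (floor (initseg r) a) a; last by exists a.
    by exists b; split; rewrite // -fab ea.
  rewrite -(def_pblock tiI AP cA); apply/same_pblock => //.
  rewrite -mn_eq // !mn_iota [X in X == _]floor_id ?setU11 //.
  have [i1 i2 _] := floorP (initseg r) c.
  move: i1; rewrite /stops in_setU1 in_setC in_set => /orP[/eqP-> //|].
  rewrite -ltnNge => lt; case/eqP: nc; apply: floor_id.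
  by rewrite /stops in_setU1 in_setC in_set -ltnNge (leq_trans lt) ?orbT.
apply/forall_inP=> A AP; apply/forall_inP=> B BP; apply/implyP=> /andP[A1 B1].
by rewrite (key A AP A1) (key B BP B1) eqxx.
Qed.

(** A nonzero p in A shares its block with p - 1, so this block is big and equals that of 1, which
    contains 0. Thus every q from 1 to p lies in A, and A is closed downwards. *)
Lemma one_big_block_iota A (o : 'I_n) : val o = 1 -> z0 \in A -> o \in A ->
  one_big_block (iota_part A) -> forall r, #|A| = r.+1 -> A = initseg r.
Proof.
move=> o1 zA oA /forall_inP big r cA.
have pI := iota_is_part A; have tiI : trivIset (iota_part A) by case/and3P: pI.
have step p : p \in A -> 0 < p -> pblock (iota_part A) p = pblock (iota_part A) z0.
  have key (q : 'I_n) : q \in A -> 0 < q -> 1 < #|pblock (iota_part A) q|.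
    move=> qA q0; have [i1 i2 h] := floorP A q.
    apply/card_gt1P; exists (floor A q), q.
    rewrite mem_block // -mn_iota mn_in //; split=> //; rewrite mn_iota.
    apply: contraL i1 => /eqP->; rewrite /stops in_setU1 in_setC qA orbF.
    by rewrite -val_eqE /= -lt0n.
  have o0 : 0 < o by rewrite [nat_of_ord o]o1.
  have zo : pblock (iota_part A) o = pblock (iota_part A) z0.
    apply/same_pblock => //; rewrite -mn_eq // !mn_iota [X in X == _]floor_id ?setU11 //.
    have [i1 i2 _] := floorP A o; move: i2; rewrite [nat_of_ord o]o1 leq_eqVlt.
    case/orP=> [/eqP e1|]; last by rewrite ltnS leqn0 => /eqP e; apply/eqP/val_inj.
    move: i1; rewrite (_ : floor A o = o); last by apply/val_inj; rewrite /= e1 o1.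
    by rewrite /stops in_setU1 in_setC oA orbF eq_sym.
  move=> pA p0; rewrite -zo.
  have mem q : pblock (iota_part A) q \in iota_part A by rewrite pblock_mem ?cover_part.
  have /forall_inP/(_ _ (mem o))/implyP h := big _ (mem p).
  by apply/eqP/h; rewrite !key.
have down p q : p \in A -> q <= p -> q \in A.
  move=> pA qp; have [p0|p0] := posnP p.
    by rewrite (_ : q = z0) //; apply/val_inj/eqP; rewrite /= -leqn0 -p0.
  have f0 : floor A p = z0.
    rewrite -[RHS](@floor_id A) ?setU11 // -!mn_iota; apply/esym/eqP.
    by rewrite mn_eq // -(step p pA p0) mem_block.
  apply: contraT => qA; have [_ _ /(_ q)] := floorP A p.
  rewrite /stops in_setU1 in_setC qA orbT => /(_ isT qp); rewrite f0 leqn0 => /eqP q0.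
  by case/negP: qA; rewrite (_ : q = z0) //; apply/val_inj.
apply/eqP; rewrite eqEcard card_initseg cA leqnn andbT; apply/subsetP=> p pA.
rewrite in_set -ltnS -cA -card_initseg; apply/subset_leq_card/subsetP=> q.
by rewrite in_set; apply: down.
Qed.

(** The hypothesis gives w q <= q for all q; by strong induction an injective map with this property
    fixes every point. *)
Lemma perm_initseg_id (w : 'S_n) : (forall r, w @: initseg r = initseg r) -> w = 1%g.
Proof.
move=> h; apply/permP=> p; rewrite perm1; apply/val_inj.
have le q : w q <= q by have : w q \in w @: initseg q by [rewrite imset_f ?inE]; rewrite h inE.
have [m pm] : exists m : nat, p <= m by exists p.
elim/ltn_ind: m p pm => m IH p pm.
apply/eqP; rewrite eqn_leq le leqNgt; apply/negP=> lt.
have lt' : w p < m := leq_trans lt pm.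
have e : w (w p) = w p by apply/val_inj/(IH (w p) lt').
by move/perm_inj: e lt => ->; rewrite ltnn.
Qed.

End IntervalPartitions.

(** * The signed sum z and its symmetrization *)

Section InvariantCycle.
Local Open Scope ring_scope.
Variable n : nat.
Hypothesis n2 : (2 < n)%N.
Variable S : {set 'I_n}.
Hypothesis bS : forall r, r \in S -> (1 < r < n.-1)%N.
Implicit Types (C : {set {set {set 'I_n}}}) (w g : 'S_n) (T U : {set 'I_n}) (r : 'I_n).

Let bS0 r : r \in S -> (0 < r < n.-1)%N.
Proof. by case/bS/andP=> /ltnW-> ->. Qed.

Definition initseg_perms : {set 'S_n} :=
  [set w : 'S_n | [forall r, (r \notin S) ==> (w @: initseg r == initseg r)]].

Lemma initseg_permsP w :
  reflect (forall r, r \notin S -> w @: initseg r = initseg r) (w \in initseg_perms).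
Proof.
rewrite inE; apply: (iffP forallP) => h r; first by move/(implyP (h r))/eqP.
by apply/implyP=> /h->.
Qed.

Lemma imset_perm1 (A : {set 'I_n}) : (1%g : 'S_n) @: A = A.
Proof. by rewrite -[RHS]imset_id; apply: eq_imset => q; rewrite perm1. Qed.

Lemma initseg_perms1 : 1%g \in initseg_perms.
Proof. by apply/initseg_permsP=> r _; apply: imset_perm1. Qed.

Definition block_at w r := iota_part n2 (w @: initseg r).

Definition cycle_chain w := [set block_at w r | r in S].

(** As 0 and 1 are not in S, w preserves I_0 and I_1, which lie inside I_r. *)
Lemma initseg_perms_small w (k : nat) (kn : (k < n)%N) : (k <= 1)%N ->
  w \in initseg_perms -> forall r, r \in S -> Ordinal kn \in w @: initseg r.
Proof.
move=> k1 /initseg_permsP h r /bS/andP[r1 _].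
have kS : Ordinal kn \notin S by apply/negP=> /bS /=; rewrite ltnNge k1.
have : Ordinal kn \in w @: initseg (Ordinal kn) by rewrite h // inE.
apply/subsetP/imsetS/subsetP=> q; rewrite !inE => /leq_trans-> //=.
by rewrite (leq_trans k1) // ltnW.
Qed.

Lemma rank_block_at w r : w \in initseg_perms -> r \in S -> Pi_rank (block_at w r) = r.
Proof.
move=> wW rS; rewrite rank_iota; last exact: initseg_perms_small wW _ rS.
by rewrite card_imset ?card_initseg //; apply: perm_inj.
Qed.

Lemma cycle_chain_chains w : w \in initseg_perms -> cycle_chain w \in chains S.
Proof.
move=> wW; rewrite inE; apply/andP; split.
  apply/andP; split.
    apply/subsetP=> _ /imsetP[r rS ->]; apply: mem_Pi_proper => //.
      exact: iota_is_part.
    by rewrite rank_block_at ?bS0.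
  apply/forall_inP=> _ /imsetP[r rS ->]; apply/forall_inP=> _ /imsetP[s sS ->].
  have mono (a b : 'I_n) : (a <= b)%N -> refines (block_at w a) (block_at w b).
    move=> ab; apply/iota_refines/imsetS/subsetP=> q.
    by rewrite !inE => /leq_trans->.
  by have /orP[] := leq_total r s => /mono->; rewrite ?orbT.
apply/eqP/setP=> r; rewrite inE; apply/exists_inP/idP => [[_ /imsetP[s sS ->]]|rS].
  by rewrite rank_block_at // => /eqP/val_inj<-.
by exists (block_at w r); rewrite ?imset_f ?rank_block_at.
Qed.

Lemma restr_cycle_chain U w : U \subset S -> w \in initseg_perms ->
  restr U (cycle_chain w) = [set block_at w r | r in U].
Proof.
move=> US wW; apply/setP=> P; rewrite inE; apply/andP/imsetP.
  case=> /imsetP[r rS ->]; rewrite (rankedE U (rank_block_at wW rS)) => rU.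
  by exists r.
case=> r rU ->; have rS := subsetP US r rU.
by rewrite imset_f // (rankedE U (rank_block_at wW rS)).
Qed.

Definition cycle_sum C : rat :=
  \sum_(w in initseg_perms) (-1) ^+ odd_perm w * (C == cycle_chain w)%:R.

(** Q may select a union of fibres because the fibres met later are those of orbits. Multiplication
    by [tau], which is applied before w, reverses the sign and changes w(I_r) only at r = t. *)
Lemma cycle_sum_fibre (Q : pred {set {set {set 'I_n}}}) t : t \in S ->
  \sum_(C in chains S | Q (restr (S :\ t) C)) cycle_sum C = 0.
Proof.
move=> tS; rewrite exchange_big /=.
have t1n : (t.+1 < n)%N.
  by have /andP[_] := bS tS; rewrite -ltnS prednK // (leq_trans _ n2).
pose t1 := Ordinal t1n; pose tau : 'S_n := tperm t t1.
have tau_initseg r : r != t -> tau @: initseg r = initseg r.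
  move=> ne; apply/eqP; rewrite eqEcard card_imset ?leqnn ?andbT; last exact: perm_inj.
  have lt_t : (t <= r)%N = (t1 <= r)%N.
    by rewrite /= [LHS]leq_eqVlt val_eqE eq_sym (negPf ne).
  apply/subsetP=> _ /imsetP[q + ->]; rewrite !inE.
  by case: tpermP => [->|->|//]; rewrite lt_t.
have tauK w : (tau * (tau * w))%g = w by rewrite mulgA tperm2 mul1g.
have tauI w r : r != t -> (tau * w)%g @: initseg r = w @: initseg r.
  move=> ne; rewrite -[in RHS](tau_initseg r ne) -imset_comp.
  by apply: eq_imset => q /=; rewrite permM.
have tauW w : ((tau * w)%g \in initseg_perms) = (w \in initseg_perms).
  suff h v : v \in initseg_perms -> (tau * v)%g \in initseg_perms.
    by apply/idP/idP => [/h|/h//]; rewrite tauK.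
  move/initseg_permsP=> hv; apply/initseg_permsP=> r rS; rewrite tauI ?hv //.
  by apply: contraNneq rS => ->.
have E w : w \in initseg_perms ->
    \sum_(C in chains S | Q (restr (S :\ t) C)) (-1) ^+ odd_perm w * (C == cycle_chain w)%:R =
    (-1) ^+ odd_perm w * (Q [set block_at w r | r in S :\ t])%:R :> rat.
  move=> wW; rewrite -mulr_sumr; congr (_ * _).
  rewrite big_mkcond (bigD1 (cycle_chain w)) //= big1 ?addr0 => [|C ne].
    rewrite cycle_chain_chains // restr_cycle_chain ?subD1set // eqxx.
    by case: (Q _).
  by rewrite (negPf ne); case: ifP.
rewrite (eq_bigr _ E); set x := \sum_(w in _) _.
suff /eqP : - x = x by rewrite eqNr => /eqP.
rewrite {2}/x (reindex_inj (mulgI tau)) -sumrN; apply: eq_big => [w|w wW].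
  by rewrite tauW.
rewrite odd_permM odd_tperm (_ : t != t1) /=; last by rewrite -val_eqE /= ltn_eqF.
rewrite signrN mulNr; congr (- (_ * (Q _)%:R)).
by apply: eq_in_imset => r; rewrite !inE => /andP[ne _]; rewrite /block_at tauI.
Qed.

Lemma cycle_chain_orbit w g : w \in initseg_perms ->
  chain_act n (cycle_chain 1) g = cycle_chain w -> w = 1%g.
Proof.
move=> wW e.
have oneW := initseg_perms1.
have n1 : (1 < n)%N := ltnW n2.
apply: perm_initseg_id => r; have [rS|] := boolP (r \in S); last exact: (initseg_permsP w wW).
have : block_at w r \in chain_act n (cycle_chain 1) g by rewrite e imset_f.
case/imsetP=> _ /imsetP[s sS ->] eP.
have sr : s = r.
  apply/val_inj; rewrite /= -(rank_block_at wW rS) eP /Pi_rank card_part_act.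
  by rewrite -/(Pi_rank _) rank_block_at.
have big : one_big_block (block_at w r).
  rewrite eP; apply: one_big_block_act.
  by rewrite /block_at imset_perm1; apply: one_big_block_initseg.
apply: (@one_big_block_iota n n2 (w @: initseg r) (Ordinal n1) erefl _ _ big r).
- exact: initseg_perms_small wW _ rS.
- exact: initseg_perms_small wW _ rS.
- by rewrite card_imset ?card_initseg //; apply: perm_inj.
Qed.

(** Symmetrizing z keeps its fibre sums zero. Its value at the chain of w = 1 counts the g fixing
    this chain, among them g = 1. *)
Lemma rank_prim_key_gt0 : (0 < \rank (prim_mx (@key n S [set: 'S_n]%G) S))%N.
Proof.
pose f C := \sum_g cycle_sum (chain_act n C g).
have f_act C g : f (chain_act n C g) = f C.
  rewrite /f [RHS](reindex_inj (mulgI g)); apply: eq_bigr => h _.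
  by rewrite actM.
pose u : 'rV[rat]_#|chains S| := \row_i f (enum_val i).
have uP : (u <= prim_mx (@key n S [set: 'S_n]%G) S)%MS.
  apply/sub_prim_mxP; split=> [i j|t tS o].
    rewrite /key !restr_id ?enum_valP // => /orbit_eqP/orbitP[g _ e].
    by rewrite !mxE -e f_act.
  pose Q C := orbit (chain_act n) [set: 'S_n] C == o.
  transitivity (\sum_(C in chains S | Q (restr (S :\ t) C)) f C).
    by rewrite big_enum_val_cond; apply: eq_bigr => i _; rewrite mxE.
  rewrite exchange_big big1 // => g _.
  apply: etrans (cycle_sum_fibre Q tS); rewrite [RHS](reindex_inj (act_inj (chain_act n) g)).
  apply: eq_bigl => C; rewrite chain_act_chains restr_act; congr (_ && (_ == _)).
  by apply/orbit_eqP; rewrite orbit_sym mem_orbit ?inE.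
rewrite lt0n mxrank_eq0; apply/negP=> /eqP e0; move: uP; rewrite e0 submx0 => /eqP u0.
have oneW := initseg_perms1.
have CS := cycle_chain_chains oneW.
have /rowP/(_ (enum_rank_in CS (cycle_chain 1))) := u0.
rewrite !mxE enum_rankK_in // /f => /eqP; apply/negP; rewrite gt_eqF //.
have E g : cycle_sum (chain_act n (cycle_chain 1) g) =
    (chain_act n (cycle_chain 1) g == cycle_chain 1)%:R.
  rewrite /cycle_sum (bigD1 1%g) //= odd_perm1 mul1r big1 ?addr0 // => w /andP[wW w1].
  case: eqP => [/(cycle_chain_orbit wW) w1'|]; last by rewrite mulr0.
  by rewrite w1' eqxx in w1.
rewrite (bigD1 1%g) //= E act1 eqxx ltr_pwDl ?ltr01 ?sumr_ge0 // => g _.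
by rewrite E ler0n.
Qed.

End InvariantCycle.

Theorem theorem2p1 (n : nat) (S : {set 'I_n}) :
  (3 <= n)%N ->
  (forall i : 'I_n, i \in S -> (1 <= i <= n - 2)%N) ->
  (forall i : 'I_n, i \in S -> nat_of_ord i <> 1%N) ->
  (0 < b_mult S)%R.
Proof.
move=> n2 bS nS1.
have bS' (r : 'I_n) : r \in S -> (1 < r < n.-1)%N.
  move=> rS; have /andP[r0 rn] := bS r rS; apply/andP; split.
    by rewrite ltn_neqAle r0 andbT eq_sym; apply/eqP/nS1.
  by apply: leq_ltn_trans rn _; case: n n2 {S bS nS1 r rS r0} => [|[|m]] // _; rewrite subn2.
rewrite b_mult_rank // => [|r /bS'/andP[/ltnW-> ->]//].
by rewrite ltr0n rank_prim_key_gt0.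
Qed.
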